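(* Let $x,y,z$ be nonnegative integers with $x\not\equiv z\pmod 2$, and let $\mathbf a=(a_1,\dots,a_m)$, $\mathbf b=(b_1,\dots,b_n)$, $\mathbf c=(c_1,\dots,c_k)$ be sequences of nonnegative integers with $m,n,k$ positive even integers. Put $g=\lfloor\frac{x+z}{2}\rfloor$, $g'=\lceil\frac{x+z}{2}\rceil$, $\mu=\max(a,b)$, $\nu=\min(a,b)$. Then \begin{align*} \operatorname{M}(Q^{\leftarrow}_{x,y,z}(\mathbf a;\mathbf c;\mathbf b))=&\operatorname{M}(C_{x,2y+z+2\mu,z}(c))\\ &\times s\left(a_1,\dots,a_{m-1},a_m+g,c_1,\dots,c_{k-1},c_k+g'+b_n,b_{n-1},\dots,b_1\right)\\ &\times s\left(y+b-\nu,a_1,\dots,a_m,g+c_1,c_2,\dots,c_k,g',b_n,\dots,b_1,y+a-\nu\right)\\ &\times\frac{\operatorname{H}(c+g)}{\operatorname{H}(c)\operatorname{H}(g)}\frac{\operatorname{H}(\mu+y+g)}{\operatorname{H}(\mu+c+y+g)}\\ &\times \frac{\operatorname{H}(\mu+y+z)\operatorname{H}(\mu+c+y+z)}{\operatorname{H}(o_a+o_b+o_c+z)\operatorname{H}(|a-b|+e_a+e_b+e_c+2y+z)}\\ &\times \frac{\operatorname{H}(o_a+o_b+o_c)\operatorname{H}(|a-b|+e_a+e_b+e_c+2y)}{\operatorname{H}(\mu+y)^2}. \end{align*}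
   Context: Work on the triangular lattice drawn with horizontal lattice lines. A lozenge is the union of two unit triangles sharing an edge; a (lozenge) tiling of a region is a covering by lozenges without gaps or overlaps; $\operatorname{M}(R)$ denotes the number of tilings of $R$. Vertical distances are measured in rows (the height of a unit triangle); ''the horizontal lattice line at level $t$ above a point $P$'' is the horizontal lattice line $t$ rows above $P$. Lattice hexagons have all angles $120^\circ$ and their side-lengths are listed clockwise starting from the horizontal top side: north, northeast, southeast, south, southwest, northwest. The east vertex is the common vertex of the northeast and southeast sides; the west vertex is the common vertex of the southwest and northwest sides. Hyperfactorial: $\operatorname{H}(n)=0!\,1!\cdots(n-1)!$ for nonnegative integers $n$ ($\operatorname{H}(0)=1$). For a sequence $\mathbf t=(t_1,\dots,t_r)$ of nonnegative integers, $o_t=\sum_{i\text{ odd}}t_i$, $e_t=\sum_{i \text{ even}}t_i$, and $t=t_1+\dots+t_r$; so $a,b,c,o_a,e_a,o_b,\dots$ refer to $\mathbf a,\mathbf b,\mathbf c$. Dented semihexagon: $s(t_1,\dots,t_r)$ is the number of tilings of the region obtained from the trapezoid with horizontal top side of length $e_t$, horizontal bottom side of length $o_t+e_t$, and two slanted sides of length $o_t$, by removing from its bottom side up-pointing triangles of side-lengths $t_1,t_3,t_5,\dots$ from left to right, the first starting at the left end of the bottom side and consecutive removed triangles separated along the bottom side by distances $t_2,t_4,\dots$. (Equivalently, $s(t_1,\dots,t_{2l-1})=s(t_1,\dots,t_{2l})=\frac{1}{\operatorname{H}(t_1+t_3+\dots+t_{2l-1})}\frac{\prod_{1\le i<j\le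 2l-1,\ j-i\text{ odd}}\operatorname{H}(t_i+\dots+t_j)}{\prod_{1\le i<j\le 2l-1,\ j-i\text{ even}}\operatorname{H}(t_i+\dots+t_j)}$.) Cored hexagon: for nonnegative integers $X,Y,Z,p$, $C_{X,Y,Z}(p)$ is obtained from the hexagon $H$ with side-lengths $X,Y+p,Z,X+p,Y,Z+p$ as follows. Let $H_0$ be the hexagon with side-lengths $X,Y,Z,X,Y,Z$ whose south, southwest and northwest sides lie on the lines of the south, southwest and northwest sides of $H$; let $O$ be the center of symmetry of $H_0$. Remove the up-pointing triangle of side $p$ whose left vertex is: $O$ if $X,Y,Z$ all have the same parity; the point $1/2$ unit west of $O$ if $X$ has parity different from $Y$ and $Z$; the point $1/2$ unit from $O$ in the northwest lattice direction if $Y$ has parity different from $X$ and $Z$; the point $1/2$ unit from $O$ in the southwest lattice direction if $Z$ has parity different from $X$ and $Y$. Fern: a string of lattice triangles of side-lengths $t_1,\dots,t_r$ (side $0$ allowed) with alternating orientations, all having a horizontal side on a common horizontal lattice line $\ell$ (up-pointing ones above $\ell$, down-pointing ones below), consecutive triangles meeting at a vertex on $\ell$; it occupies a segment of $\ell$ of length $t_1+\dots+t_r$. Removing a fern means removing the union of its triangles. The region $Q^{\leftarrow}_{x,y,z}(\mathbf a;\mathbf c;\mathbf b)$ (for $x\not\equiv z \pmod 2$): with $O=o_a+o_b+o_c$ and $E=e_a+e_b+e_c$, let $H$ be the hexagon with side-lengths $x+E$, $y+z+O+\max(a-b,0)$, $y+z+E+\max(b-a,0)$, $x+O$, $y+z+E+\max(a-b,0)$,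 $y+z+O+\max(b-a,0)$. Let $\ell$ be the horizontal lattice line at level $y+\max(a-b,0)$ above the east vertex of $H$ (equivalently, $z+O$ rows below the north side); $\ell\cap H$ is a segment of length $x+z+a+b+c$ with endpoints on the northwest and northeast sides. Remove from $H$ three ferns along $\ell$: the left fern with side-lengths $a_1,\dots,a_m$ from left to right, $a_1$ up-pointing, starting at the left endpoint of $\ell\cap H$; the right fern with side-lengths $b_1,\dots,b_n$ read from right to left, $b_1$ up-pointing, ending at the right endpoint of $\ell\cap H$; and the middle fern with side-lengths $c_1,\dots,c_k$ from left to right, $c_1$ up-pointing, placed so that the distance along $\ell$ from the right end of the left fern to the left end of the middle fern is $\lfloor\frac{x+z}{2}\rfloor$ and the distance from the right end of the middle fern to the left end of the right fern is $\lceil\frac{x+z}{2}\rceil$. *)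

(* Defs.v *)
From HB Require Import structures.
From mathcomp Require Import all_boot all_order all_algebra.
From mathcomp Require Import finmap.

Set Implicit Arguments.
Unset Strict Implicit.
Unset Printing Implicit Defensive.

Local Open Scope fset_scope.
Local Open Scope nat_scope.

(** Lattice points are pairs [(i, j)] standing for [i * u + j * v], where [u] is
    the unit vector pointing east and [v] the unit vector at angle 60 degrees.
    Thus [j] is the level (in rows), and the three families of lattice lines are
    [j = cst], [i = cst] (direction northeast) and [i + j = cst] (direction
    northwest).  Every region below is drawn inside the quadrant of nonnegative
    coordinates. *)
Definition point : Type := (nat * nat)%type.

(** [(true, (i, j))] is the up-pointing unit triangle with left vertex [(i, j)];
    [(false, (i, j))] is the down-pointing one sharing its right side. *)
Definition utri : Type := (bool * (nat * nat))%type.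

Definition vertices (t : utri) : seq (nat * nat) :=
  let: (up, (i, j)) := t in
  if up then [:: (i, j); (i.+1, j); (i, j.+1)]
  else [:: (i.+1, j); (i, j.+1); (i.+1, j.+1)].

Definition inside (S : pred point) (t : utri) : bool := all S (vertices t).

Definition share_edge (t u : utri) : bool :=
  count (mem (vertices u)) (vertices t) == 2.

Definition is_lozenge (R : {fset utri}) (B : {set R}) : bool :=
  [exists t : R, exists u : R,
    share_edge (val t) (val u) && (B == [set t; u]%SET)].

Definition is_tiling (R : {fset utri}) (P : {set {set R}}) : bool :=
  partition P [set: R]%SET && [forall B in P, is_lozenge B].

Definition tilings (R : {fset utri}) : nat :=
  #|[set P : {set {set R}} | is_tiling P]%SET|.

(** The hexagon with the given side-lengths (clockwise from the north side),
    placed with its south side on [j = 0] and its northwest side on [i = 0]; its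
    vertices are, clockwise from the west one, [(0, sw)], [(0, sw + nw)],
    [(n, sw + nw)], [(n + ne, se)], [(sw + s, 0)] and [(sw, 0)].  It closes up
    when [sw + nw = ne + se] and [n + ne = sw + s]. *)
Definition hexagon (n ne se s sw nw : nat) : {fset utri} :=
  [fset t in [seq (up, p) | up <- [:: true; false],
                 p <- [seq (i, j) | i <- iota 0 (n + ne).+1,
                                    j <- iota 0 (sw + nw).+1]]
   | inside (fun q => [&& q.1 <= n + ne, q.2 <= sw + nw
                        & sw <= q.1 + q.2 <= sw + s + se]) t].

(** [triangle up p (i, j)]: the points of the triangle of side [p] whose
    horizontal side goes from [(i, j)] to [(i + p, j)]. *)
Definition triangle (up : bool) (p : nat) (v : point) : pred point := fun q =>
  if up then [&& v.1 <= q.1, v.2 <= q.2 & q.1 + q.2 <= v.1 + v.2 + p]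
  else [&& q.1 <= v.1 + p, q.2 <= v.2 & v.1 + v.2 <= q.1 + q.2].

Definition remove (R : {fset utri}) (D : seq (pred point)) : {fset utri} :=
  [fset t in R | ~~ has (fun S => inside S t) D].

(** The triangles of a fern, from left to right, starting at the point [(i, j)]
    with a triangle of orientation [up]. *)
Fixpoint fern (up : bool) (i j : nat) (ts : seq nat) : seq (pred point) :=
  if ts is t :: ts' then triangle up t (i, j) :: fern (~~ up) (i + t) j ts'
  else [::].

Definition hyperfact (n : nat) : nat := \prod_(i < n) i`!.

(** Sequences [t_1, t_2, ...] are stored from position 0, so the odd-indexed
    terms are those in even positions. *)
Definition osum (t : seq nat) : nat := \sum_(i < size t | ~~ odd i) nth 0 t i.
Definition esum (t : seq nat) : nat := \sum_(i < size t | odd i) nth 0 t i.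

Fixpoint dents (i : nat) (ts : seq nat) : seq (pred point) :=
  match ts with
  | t1 :: t2 :: ts' => triangle true t1 (i, 0) :: dents (i + t1 + t2) ts'
  | [:: t1] => [:: triangle true t1 (i, 0)]
  | [::] => [::]
  end.

(** The trapezoid is a hexagon whose southeast and southwest sides have
    length 0; its bottom side starts at [(0, 0)]. *)
Definition dented_semihexagon (t : seq nat) : {fset utri} :=
  let o := osum t in let e := esum t in
  remove (hexagon e o 0 (o + e) 0 o) (dents 0 t).

Definition semihex (t : seq nat) : nat := tilings (dented_semihexagon t).

(** Left vertex of the core.  In the coordinates of [hexagon], the center of
    the auxiliary hexagon with sides X, Y, Z, X, Y, Z is the midpoint
    [((X + Y) / 2, (Y + Z) / 2)] of its west vertex [(0, Y)] and its east vertex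
    [(X + Y, Z)].  Half a unit west, northwest, southwest changes the doubled
    coordinates by (-1, 0), (-1, +1), (0, -1) respectively. *)
Definition core_vertex (X Y Z : nat) : point :=
  if (odd X == odd Y) && (odd Y == odd Z) then ((X + Y)./2, (Y + Z)./2)
  else if odd Y == odd Z then ((X + Y).-1./2, (Y + Z)./2)
  else if odd X == odd Z then ((X + Y).-1./2, (Y + Z).+1./2)
  else ((X + Y)./2, (Y + Z).-1./2).

Definition cored_hexagon (X Y Z p : nat) : {fset utri} :=
  remove (hexagon X (Y + p) Z (X + p) Y (Z + p))
         [:: triangle true p (core_vertex X Y Z)].

(** [a - b] and [b - a] are truncated, i.e. max(a-b,0) and max(b-a,0).  The
    east vertex of the hexagon is at level [se].  The right fern, read from left
    to right, is [rev tb]; its leftmost triangle (the last term of [tb]) is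
    up-pointing iff [size tb] is odd. *)
Definition Qleft (x y z : nat) (ta tc tb : seq nat) : {fset utri} :=
  let a := sumn ta in let b := sumn tb in let c := sumn tc in
  let O := osum ta + osum tb + osum tc in
  let E := esum ta + esum tb + esum tc in
  let se := y + z + E + (b - a) in
  let l := se + (y + (a - b)) in
  remove
    (hexagon (x + E) (y + z + O + (a - b)) se
             (x + O) (y + z + E + (a - b)) (y + z + O + (b - a)))
    (fern true 0 l ta
     ++ fern true (a + (x + z)./2) l tc
     ++ fern (odd (size tb)) (a + (x + z)./2 + c + uphalf (x + z)) l (rev tb)).

Definition add_head (d : nat) (s : seq nat) : seq nat :=
  set_nth 0 s 0 (head 0 s + d).

Definition add_last (d : nat) (s : seq nat) : seq nat :=
  set_nth 0 s (size s).-1 (last 0 s + d).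

(* Main.v *)
Require Import Defs.
From HB Require Import structures.
From mathcomp Require Import all_boot all_order all_algebra.
From mathcomp Require Import finmap zify ring.

(** Cut the region along the line carrying the ferns: exactly z lozenges cross
    it, at positions S in the two gaps.  Both halves are dented trapezoids, whose
    tilings are counted (Cohn, Larsen and Propp) by the Vandermonde product of
    the dent positions divided by a hyperfactorial.  Hence the summand attached
    to S is a constant, times the squared Vandermonde product of S, times the
    distances from S to all positions occupied above or below the line.  Each
    position of a fern is occupied exactly once, above or below, so these
    positions form three full blocks of lengths y + max(a, b), c, y + max(a, b):
    the sum over S does not depend on how the ferns are subdivided.  Cutting the
    cored hexagon along the base of its core yields the same sum, and the two
    constants are the Vandermonde products counting the two semihexagons. *)

Set Implicit Arguments.
Unset Strict Implicit.
Unset Printing Implicit Defensive.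

Local Open Scope fset_scope.
Local Open Scope nat_scope.

(** * Perfect matchings and the expansion along a unit triangle *)

(** The two halves of each region become trapezoids only after corner triangles are added and
    counted as removed. In the region with ferns the line runs [alpha = y + max(b-a,0)] rows above
    the west vertex and [beta = y + max(a-b,0)] rows above the east one, so corners of these sides
    complete the lower half. Since [alpha + a = beta + b = y + max(a,b)], each outer fern merges
    with its corner into a block of the same length; this is the purpose of the offsets in the
    side-lengths of the hexagon. In the cored hexagon the base of the core runs below the west
    vertex and above the east one, so one corner of side [y + max(a,b)] lies above the line and one
    below: this fixes its parameter [2y + z + 2 max(a,b)]. The number of crossing lozenges is forced
    by balance: a trapezoid with n rows has tilings only if n unit dents are made in its base. Its
    count is proved by sweeping the bottom row from left to right, which gives the recurrence of a
    determinant of binomial coefficients; that determinant is Vandermonde up to column scaling and a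
    unitriangular change of basis. The common sum over S is never evaluated. *)

Section Matchings.

Variables (T : finType) (e : rel T).

Definition edge_block (B : {set T}) : bool :=
  [exists t : T, exists u : T, e t u && (B == [set t; u])].

Definition matching_of (A : {set T}) (P : {set {set T}}) : bool :=
  partition P A && [forall B in P, edge_block B].

Definition matchings (A : {set T}) : nat := #|[set P | matching_of A P]|.

Hypotheses (e_sym : symmetric e) (e_irr : irreflexive e).

Lemma matchings0 : matchings set0 = 1.
Proof.
rewrite /matchings; apply/eqP/cards1P; exists set0; apply/setP => P.
rewrite !inE /matching_of partition_set0; case: eqP => //= ->.
by apply/forall_inP => B; rewrite inE.
Qed.

Lemma edge_blockE v (B : {set T}) : v \in B -> edge_block B ->
  exists2 u, e v u & B = [set v; u].
Proof.
move=> vB /existsP[t /existsP[u /andP[etu /eqP BE]]].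
move: vB; rewrite BE !inE => /orP[] /eqP->; first by exists u.
by exists t; rewrite 1?e_sym // setUC.
Qed.

Lemma matching_at (A : {set T}) P v : matching_of A P -> v \in A ->
  exists2 u, (u \in A) && e v u & [set v; u] \in P.
Proof.
move=> /andP[pP /forall_inP eP] vA.
have vc : v \in cover P by rewrite (cover_partition pP).
have bP : pblock P v \in P by rewrite pblock_mem.
have vb : v \in pblock P v by rewrite mem_pblock.
have [u evu bE] := edge_blockE vb (eP _ bP).
exists u; last by rewrite -bE.
rewrite evu andbT; apply: (subsetP (partitionS pP bP)).
by rewrite bE !inE eqxx orbT.
Qed.

(** Adding the block [[set v; u]] is a bijection from the matchings of the remaining set. *)
Lemma card_matchings_edge (A : {set T}) v u : v \in A -> u \in A -> e v u ->
  #|[set P | matching_of A P & [set v; u] \in P]| = matchings (A :\ v :\ u).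
Proof.
move=> vA uA evu; set b := [set v; u].
have bA : A :\: b = A :\ v :\ u by apply/setP => t; rewrite !inE negb_or andbCA andbA.
have bN P : matching_of (A :\ v :\ u) P -> b \notin P.
  move=> /andP[pP _]; apply/negP => /(partitionS pP)/subsetP/(_ v).
  by rewrite !inE eqxx => /(_ isT)/andP[_ /andP[]].
rewrite /matchings -(card_in_imset (f := fun P => b |: P)
  (D := [set P | matching_of (A :\ v :\ u) P])); last first.
  move=> P Q; rewrite !inE => /bN bP /bN bQ PQ.
  by rewrite -(setU1K bP) -(setU1K bQ) PQ.
congr #|pred_of_set _|; apply/setP => P; apply/idP/imsetP => [|[Q]]; rewrite !inE.
  case/andP => /andP[pP /forall_inP eP] bP; exists (P :\ b); last by rewrite setD1K.
  rewrite inE /matching_of -bA partitionD1 //=.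
  by apply/forall_inP => B /setD1P[_ /eP].
move=> mQ ->; rewrite setU11 andbT /matching_of; case/andP: (mQ) => pQ /forall_inP eQ.
apply/andP; split.
  have AE : A = b :|: (A :\ v :\ u).
    apply/setP => t; rewrite !inE.
    by case: eqP => [->|_]; case: eqP => [->|_]; rewrite ?vA ?uA.
  rewrite AE partitionU1 //; first by apply/set0Pn; exists v; rewrite !inE eqxx.
  by rewrite -bA -setI_eq0 setDE setICA setICr setI0.
apply/forall_inP => B /setU1P[->|/eQ//].
by apply/existsP; exists v; apply/existsP; exists u; rewrite evu eqxx.
Qed.

Lemma matchings_expand (A : {set T}) v : v \in A ->
  matchings A = \sum_(u in A | e v u) matchings (A :\ v :\ u).
Proof.
move=> vA; rewrite {1}/matchings -sum1_card.
transitivity (\sum_(P in [set P | matching_of A P])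
  \sum_(u in A | e v u && ([set v; u] \in P)) 1).
  apply: eq_bigr => P; rewrite inE => mP.
  have [u /andP[uA evu] uP] := matching_at mP vA.
  rewrite (big_pred1 u) // => w /=; apply/idP/eqP => [|->]; last by rewrite uA evu.
  case/and3P => wA evw wP.
  case/andP: mP => /and3P[_ tP _] _.
  have vin x : v \in [set v; x] by rewrite !inE eqxx.
  have wu: [set v; w] = [set v; u].
    by rewrite -(def_pblock tP wP (vin w)) -(def_pblock tP uP (vin u)).
  have : w \in [set v; u] by rewrite -wu !inE eqxx orbT.
  by rewrite !inE => /orP[]/eqP // wv; move: evw; rewrite wv e_irr.
rewrite (exchange_big_dep (fun u => (u \in A) && e v u)) /=; last first.
  by move=> P u _ /and3P[-> ->].
apply: eq_bigr => u /andP[uA evu]; rewrite -card_matchings_edge // -sum1_card.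
by apply: eq_bigl => P; rewrite !inE uA evu.
Qed.

End Matchings.

(** Expanding both sides at a vertex and inducting on the cardinality avoids transporting partitions
    along [h]. *)
Lemma matchings_imset (T1 T2 : finType) (e1 : rel T1) (e2 : rel T2) (h : T1 -> T2) (A : {set T1}) :
  symmetric e1 -> irreflexive e1 -> symmetric e2 -> irreflexive e2 ->
  injective h -> (forall x y, e2 (h x) (h y) = e1 x y) ->
  matchings e2 (h @: A) = matchings e1 A.
Proof.
move=> s1 i1 s2 i2 inj_h he.
have [n] := ubnP #|A|; elim: n A => // n IH A leA.
have [->|[v vA]] := set_0Vmem A; first by rewrite imset0 !matchings0.
rewrite (matchings_expand s1 i1 vA) (matchings_expand s2 i2 (imset_f h vA)).
rewrite big_mkcondr big_imset /=; last by move=> ? ? _ _ /inj_h.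
rewrite [RHS]big_mkcondr /=; apply: eq_bigr => u uA; rewrite he.
case: ifP => // evu; rewrite -IH; last first.
  by rewrite -ltnS; apply: leq_trans leA; rewrite [#|A|](cardsD1 v) vA !ltnS subset_leq_card // subD1set.
congr matchings; apply/setP => w; apply/idP/imsetP => [|[x]].
  rewrite !inE => /and3P[wu wv /imsetP[x xA wE]]; exists x => //.
  by rewrite !inE xA -!(inj_eq inj_h) -wE wu wv.
by rewrite !inE => /and3P[xu xv xA] ->; rewrite !(inj_eq inj_h) xu xv imset_f.
Qed.


(** * Tilings of finite regions as matchings for adjacency *)

Definition adj (t u : utri) : bool :=
  let: (s, (i, j)) := t in let: (s', (i', j')) := u in
  match s, s' with
  | true, false => (j == j') && ((i == i') || (i == i'.+1)) || (j == j'.+1) && (i == i')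
  | false, true => (j == j') && ((i == i') || (i.+1 == i')) || (j.+1 == j') && (i == i')
  | _, _ => false
  end.

Lemma share_edgeE t u : share_edge t u = adj t u.
Proof.
move: t u => [s [i j]] [s' [i' j']]; rewrite /share_edge /adj.
(* The equality tests are about to be generalized to arbitrary Booleans; [excl] keeps the fact that
   at most one of the three tests holds in each coordinate. *)
have excl m n : [&& ~~ ((m == n) && (m == n.+1)), ~~ ((m == n) && (m.+1 == n))
    & ~~ ((m == n.+1) && (m.+1 == n))] by lia.
have := excl i i'; have := excl j j'; rewrite {excl}.
case: s; case: s' => /=; rewrite !inE !xpair_eqE ?eqSS;
move: (i == i') (i == i'.+1) (i.+1 == i') (j == j') (j == j'.+1) (j.+1 == j');
by do 6 case.
Qed.

Lemma adj_sym : symmetric adj.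
Proof. by move=> [s [i j]] [s' [i' j']]; rewrite /adj; case: s; case: s' => //; lia. Qed.

Lemma adj_irr : irreflexive adj.
Proof. by move=> [[] [i j]]. Qed.

Lemma tilingsE (R : {fset utri}) :
  tilings R = matchings (fun t u : R => adj (val t) (val u)) setT.
Proof.
rewrite /tilings /matchings; congr #|pred_of_set _|; apply/setP => P; rewrite !inE.
congr (_ && _); apply: eq_forallb => B; congr (_ ==> _).
by apply: eq_existsb => t; apply: eq_existsb => u; rewrite share_edgeE.
Qed.

(** The type underlying [tilings A] changes with [A]; counting inside the fixed type of [R] makes
    the general expansion available when triangles are deleted. *)
Lemma tilings_sub (R A : {fset utri}) : A `<=` R ->
  tilings A = matchings (fun t u : R => adj (val t) (val u)) [set t | val t \in A].
Proof.
move=> AR; rewrite tilingsE.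
have h0 (t : A) : val t \in R by apply: (fsubsetP AR); apply: valP.
rewrite -(matchings_imset (e1 := fun t u : A => adj (val t) (val u))
  (e2 := fun t u : R => adj (val t) (val u)) (h := fun t : A => FSetSub (h0 t))).
- congr matchings; apply/setP => t; rewrite inE; apply/imsetP/idP => [[u _ ->]|tA].
    exact: (fsvalP u).
  by exists (FSetSub tA) => //; apply: val_inj.
- by move=> t u; apply: adj_sym.
- by move=> t; apply: adj_irr.
- by move=> t u; apply: adj_sym.
- by move=> t; apply: adj_irr.
- by move=> t u /(congr1 val) /= /val_inj.
- by [].
Qed.

Lemma tilings_expand (R : {fset utri}) v : v \in R ->
  tilings R = \sum_(u <- R | adj v u) tilings (R `\ v `\ u).
Proof.
move=> vR; rewrite tilingsE (@matchings_expand _ _ _ _ _ (FSetSub vR)).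
- rewrite big_seq_fsetE /=; apply: eq_big => [u|u _]; first by rewrite inE.
  rewrite (@tilings_sub R); last by rewrite (fsubset_trans (fsubD1set _ _)) // fsubD1set.
  congr matchings; apply/setP => t; rewrite !inE -!val_eqE /= fsvalP !andbT.
  reflexivity.
- by move=> t u; apply: adj_sym.
- by move=> t; apply: adj_irr.
- by rewrite inE.
Qed.

Lemma tilings0 : tilings fset0 = 1.
Proof.
rewrite tilingsE (_ : [set: _] = set0) ?matchings0 //.
by apply/setP => t; have := fsvalP t; rewrite inE.
Qed.

Lemma tilings_forced (R : {fset utri}) v u :
  v \in R -> u \in R -> adj v u -> (forall w, w \in R -> adj v w -> w = u) ->
  tilings R = tilings (R `\ v `\ u).
Proof.
move=> vR uR vu uniq_u; rewrite (tilings_expand vR) big_fset_condE.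
rewrite (_ : [fset i in R | adj v i] = [fset u]) ?big_seq_fset1 //.
apply/fsetP => w; rewrite !inE /=; apply/andP/eqP => [[wR vw]|->]; last by [].
exact: uniq_u.
Qed.

Lemma tilings_stuck (R : {fset utri}) v :
  v \in R -> (forall w, w \in R -> ~~ adj v w) -> tilings R = 0.
Proof.
move=> vR stuck; rewrite (tilings_expand vR) big_seq_cond big1 // => w /andP[wR].
by rewrite (negbTE (stuck w wR)).
Qed.

(** The maps are required to be inverse only on the two regions, because the translations and
    reflections used later involve truncated subtraction. *)
Lemma tilings_iso (h h' : utri -> utri) (R1 R2 : {fset utri}) :
  (forall t, t \in R1 -> h t \in R2 /\ h' (h t) = t) ->
  (forall t, t \in R2 -> h' t \in R1 /\ h (h' t) = t) ->
  {in R1 &, forall t u, adj (h t) (h u) = adj t u} ->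
  tilings R1 = tilings R2.
Proof.
have [n] := ubnP #|` R1|; elim: n R1 R2 => // n IH R1 R2 leR h1 h2 hadj.
have [R10|[v vR]] := fset_0Vmem R1.
  have [->|[u /h2[]]] := fset_0Vmem R2; first by rewrite R10.
  by rewrite R10 inE.
have [hvR hvK] := h1 v vR.
rewrite (tilings_expand vR) (tilings_expand hvR).
have -> : \sum_(u <- R2 | adj (h v) u) tilings (R2 `\ h v `\ u) =
    \sum_(u <- R1 | adj v u) tilings (R2 `\ h v `\ h u).
  rewrite big_fset_condE [RHS]big_fset_condE.
  have -> : [fset u in R2 | adj (h v) u] = h @` [fset u in R1 | adj v u].
    apply/fsetP => w; rewrite !inE /=; apply/andP/imfsetP => [[wR vw]|[u]] /=.
      have [h'w hK] := h2 _ wR; exists (h' w) => //.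
      by rewrite !inE /= h'w -hadj // hK.
    rewrite !inE /= => /andP[uR vu] ->; have [huR _] := h1 _ uR.
    by rewrite huR hadj.
  rewrite big_imfset //= => t u; rewrite !inE /= => /andP[tR _] /andP[uR _] htu.
  by rewrite -(h1 t tR).2 -(h1 u uR).2 htu.
rewrite big_seq_cond [RHS]big_seq_cond; apply: eq_bigr => u /andP[uR vu].
have [huR huK] := h1 u uR.
apply: IH => [|t|t|t w].
- move: leR; rewrite (cardfsD1 v) vR /= add1n ltnS; apply: leq_ltn_trans.
  by rewrite fsubset_leq_card // fsubD1set.
- rewrite !inE => /and3P[tu tv tR]; have [htR htK] := h1 t tR; split => //.
  rewrite htR andbT; apply/andP; split.
    by apply: contra tu => /eqP hE; rewrite -htK hE huK.
  by apply: contra tv => /eqP hE; rewrite -htK hE hvK.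
- rewrite !inE => /and3P[tu tv tR]; have [htR htK] := h2 t tR; split => //.
  rewrite htR andbT; apply/andP; split.
    by apply: contra tu => /eqP <-; rewrite htK.
  by apply: contra tv => /eqP <-; rewrite htK.
- by rewrite !inE => /and3P[_ _ tR] /and3P[_ _ wR]; apply: hadj.
Qed.

(** * Balance of up- and down-pointing triangles *)

Definition count_up (R : {fset utri}) : nat := \sum_(t <- R) t.1.
Definition count_down (R : {fset utri}) : nat := \sum_(t <- R) ~~ t.1.

Lemma count_upD1 (R : {fset utri}) (v : utri) : v \in R -> count_up R = v.1 + count_up (R `\ v).
Proof. by move=> vR; rewrite /count_up (big_fsetD1 v). Qed.

Lemma count_downD1 (R : {fset utri}) (v : utri) :
  v \in R -> count_down R = ~~ v.1 + count_down (R `\ v).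
Proof. by move=> vR; rewrite /count_down (big_fsetD1 v). Qed.

Lemma adj_orient t u : adj t u -> u.1 = ~~ t.1.
Proof. by case: t u => [[] [i j]] [[] [i' j']]. Qed.

Lemma count_D2 (R : {fset utri}) v u : v \in R -> u \in R -> adj v u ->
  count_up R = (count_up (R `\ v `\ u)).+1 /\
  count_down R = (count_down (R `\ v `\ u)).+1.
Proof.
move=> vR uR vu; have uv : u \in R `\ v.
  by rewrite !inE uR andbT; apply: contraTneq vu => ->; rewrite adj_irr.
rewrite (count_upD1 vR) (count_upD1 uv) (count_downD1 vR) (count_downD1 uv).
by rewrite (adj_orient vu); case: v.1.
Qed.

Lemma tilings_balanced (R : {fset utri}) :
  tilings R != 0 -> count_up R = count_down R.
Proof.
have [n] := ubnP #|` R|; elim: n R => // n IH R leR.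
have [->|[v vR]] := fset_0Vmem R.
  by rewrite /count_up /count_down !big_seq_fset0.
rewrite (tilings_expand vR) big_seq_cond => nz.
have /existsP [u /andP[vu tu]] : [exists u : R, adj v (val u) && (tilings (R `\ v `\ val u) != 0)].
  apply: contraR nz => /existsPn nex; rewrite big1 // => u /andP[uR vu].
  by have := nex (FSetSub uR); rewrite /= vu /= negbK => /eqP.
have [-> ->] := count_D2 vR (fsvalP u) vu; congr _.+1; apply: IH tu.
move: leR; rewrite (cardfsD1 v) vR /= add1n ltnS; apply: leq_ltn_trans.
by rewrite fsubset_leq_card // fsubD1set.
Qed.

(* All down triangles of T are matched inside T, and T is balanced, so no
   lozenge leaves T. *)
Lemma tilings_split_off (R T : {fset utri}) : T `<=` R ->
  count_up T = count_down T ->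
  (forall v u, v \in T -> ~~ v.1 -> u \in R -> adj v u -> u \in T) ->
  tilings R = tilings T * tilings (R `\` T).
Proof.
have [n] := ubnP #|` T|; elim: n T R => // n IH T R leT /fsubsetP TR bal closed.
have [/existsP[[v vT] /= v_dn]|/existsPn no_dn] := boolP [exists v : T, ~~ (val v).1].
  rewrite (tilings_expand (TR v vT)) (tilings_expand vT) big_distrl /=.
  rewrite big_fset_condE [RHS]big_fset_condE.
  have -> : [fset u in R | adj v u] = [fset u in T | adj v u].
    apply/fsetP => u; rewrite !inE /=; apply/andP/andP => -[uR vu]; split => //.
      exact: closed vu.
    exact: TR.
  rewrite big_seq [RHS]big_seq; apply: eq_bigr => u; rewrite !inE /= => /andP[uT vu].
  rewrite (IH (T `\ v `\ u) (R `\ v `\ u)).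
  - congr (_ * tilings _); apply/fsetP => t; rewrite !inE.
    case: eqP => [->|_]; case: eqP => [->|_]; rewrite ?uT ?vT //=.
  - move: leT; rewrite (cardfsD1 v) vT /= add1n ltnS; apply: leq_ltn_trans.
    by rewrite fsubset_leq_card // fsubD1set.
  - by apply/fsubsetP => t; rewrite !inE => /and3P[-> -> /TR].
  - by have [up dn] := count_D2 vT uT vu; move: bal; rewrite up dn => -[].
  - move=> t w; rewrite !inE => /and3P[_ _ tT] t_dn /and3P[-> -> wR] tw.
    exact: closed tw.
suff -> : T = fset0 by rewrite tilings0 mul1n fsetD0.
have [->//|[v vT]] := fset_0Vmem T.
have dn0 : count_down T = 0.
  rewrite /count_down big_seq big1 // => t tT.
  by have := no_dn (FSetSub tT); rewrite negbK => /= ->.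
have := no_dn (FSetSub vT); rewrite negbK /= => v_up.
by move: bal; rewrite dn0 (count_upD1 vT) v_up.
Qed.

(** * Decomposing tilings by the lozenges that cross a cut *)

Section Cut.

Variables (I : finType) (phi psi : I -> utri).
Hypotheses (phi_inj : injective phi) (psi_inj : injective psi).
Hypothesis phi_psi : forall i, adj (phi i) (psi i).

Implicit Types (A B : {fset utri}) (S : {set I}).

Definition cut_ok A B S : bool := [forall i in S, (phi i \in A) && (psi i \in B)].

Definition erase (f : I -> utri) A S : {fset utri} :=
  [fset t in A | ~~ [exists i in S, f i == t]].

Lemma in_erase f A S t : (t \in erase f A S) = (t \in A) && ~~ [exists i in S, f i == t].
Proof. by rewrite !inE. Qed.

Lemma erase0 f A : erase f A set0 = A.
Proof.
apply/fsetP => t; rewrite in_erase; case: existsP => [[i]|_]; last by rewrite andbT.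
by rewrite inE.
Qed.

Lemma eraseD1 f A S t : erase f (A `\ t) S = erase f A S `\ t.
Proof. by apply/fsetP => w; rewrite !(inE, in_erase) andbA. Qed.

Lemma eraseU1 f A S i : erase f A (i |: S) = erase f (A `\ f i) S.
Proof.
apply/fsetP => t; rewrite !in_erase in_fsetD1 -andbA andbCA; congr (_ && _).
rewrite -negb_or; congr (~~ _); apply/existsP/orP => [[k]|[/eqP ->|/existsP[k]]].
- rewrite !inE => /andP[/orP[/eqP->|kS] /eqP <-]; first by left.
  by right; apply/existsP; exists k; rewrite kS eqxx.
- by exists i; rewrite !inE !eqxx.
- by move=> /andP[kS kt]; exists k; rewrite !inE kS kt orbT.
Qed.

(* Group the tilings of A + B by the set S of lozenges crossing from A to B. *)
Lemma tilings_cut A B : [disjoint A & B]%fset ->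
  (forall v u, v \in A -> u \in B -> adj v u -> exists2 i, v = phi i & u = psi i) ->
  tilings (A `|` B) =
    \sum_(S : {set I} | cut_ok A B S) tilings (erase phi A S) * tilings (erase psi B S).
Proof.
have [n] := ubnP #|` A|; elim: n A B => // n IH A B leA disAB cross.
have [A0|[v vA]] := fset_0Vmem A.
  rewrite A0 fset0U (big_pred1 set0) => [|S].
    by rewrite !erase0 tilings0 mul1n.
  rewrite /cut_ok /= -subset0; apply/forall_inP/subsetP => [h i /h|h i /h]; by rewrite inE.
have cardA t : #|` A `\ v `\ t| < n.
  move: leA; rewrite (cardfsD1 v) vA /= add1n ltnS; apply: leq_ltn_trans.
  by rewrite fsubset_leq_card // fsubD1set.
have disP t : t \in A -> t \in B -> False.
  by move=> tA tB; move/fdisjointP: disAB => /(_ t tA); rewrite tB.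
have vAB : v \in A `|` B by rewrite !inE vA.
(* Partners of [v] inside [A] are matched with the sets S whose lozenges avoid [v]; a partner in [B]
   is matched with the sets S that use [v]. *)
rewrite (tilings_expand vAB) (bigID (fun u => u \in A)) /=.
rewrite [RHS](bigID (fun S => [forall i in S, phi i != v])) /=; congr (_ + _).
  transitivity (\sum_(u <- A | adj v u) \sum_(S | cut_ok (A `\ v `\ u) B S)
      tilings (erase phi (A `\ v `\ u) S) * tilings (erase psi B S)).
    apply: eq_fbig_cond => [u|u]; rewrite !inE /=.
      by case: (u \in A); rewrite ?andbF ?andbT.
    move=> _ /andP[vu uA]; rewrite -IH //.
    - congr tilings; apply/fsetP => t; rewrite !inE.
      case: eqP => [->|_]; last case: eqP => [->|_]; rewrite /= ?orbF //.
        by case: (boolP (u \in B)) => // /(disP _ uA).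
      by case: (boolP (v \in B)) => // /(disP _ vA).
    - by apply/fdisjointP => t; rewrite !inE => /and3P[_ _ tA]; apply/negP => /(disP _ tA).
    - by move=> t w; rewrite !inE => /and3P[_ _ tA]; apply: cross.
  rewrite (exchange_big_dep (fun S => cut_ok A B S && [forall i in S, phi i != v])) /=.
    apply: eq_bigr => S /andP[/forall_inP okS /forall_inP nvS].
    have vS : v \in erase phi A S.
      rewrite in_erase vA; apply/existsPn => i; apply/negP => /andP[iS].
      by apply/negP/nvS.
    rewrite (tilings_expand vS) big_distrl /=; apply: eq_fbig_cond => [u|u].
      rewrite !inE /=; case: (boolP (u \in A)) => //= uA; rewrite andbC.
      congr (_ && _); apply/forall_inP/existsPn => [h i|h i iS].
        by apply/negP => /andP[/h]; rewrite !inE => /andP[/and3P[/negP]].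
      have /andP[pA pB] := okS i iS.
      by rewrite !inE pA pB (nvS i iS) !andbT; have := h i; rewrite iS.
    by move=> _; rewrite !eraseD1.
  move=> u S uA; rewrite /cut_ok => /forall_inP h; apply/andP; split.
    apply/forall_inP => i /h; rewrite !inE -!andbA => /and4P[_ _ -> ->] //.
  by apply/forall_inP => i /h; rewrite !inE -!andbA => /and4P[].
(* By [cross], the only possible partner of [v] in [B] is [psi i0] with [phi i0 = v]. If there is
   none, both remaining sums are empty. *)
have [/existsP[i0 /andP[/eqP pv pB]]|/existsPn none] :=
  boolP [exists i, (phi i == v) && (psi i \in B)]; last first.
  rewrite big_seq_cond big1 => [|u]; last first.
    rewrite !inE => /andP[/orP[uA|uB] /andP[vu uN]]; first by rewrite uA in uN.
    have [i vi ui] := cross v u vA uB vu.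
    by have := none i; rewrite -vi -ui eqxx uB.
  rewrite big1 // => S /andP[/forall_inP ok /forallPn[i]].
  rewrite negb_imply negbK => /andP[iS pi].
  by have := none i; rewrite pi; have /andP[_ ->] := ok i iS.
rewrite big_fset_condE (_ : [fset _ | _ in _ & _] = [fset psi i0]); last first.
  apply/fsetP => u; rewrite !inE /=; apply/idP/eqP => [|->]; last first.
    rewrite pB orbT -pv phi_psi /=; apply/negP => pA; exact: (disP _ pA pB).
  case/and3P => /orP[uA|uB] vu uN; first by rewrite uA in uN.
  have [i vi ->] := cross v u vA uB vu.
  by congr psi; apply: phi_inj; rewrite -vi pv.
rewrite big_seq_fset1.
have -> : (A `|` B) `\ v `\ psi i0 = (A `\ v) `|` (B `\ psi i0).
  apply/fsetP => t; rewrite !inE; case: eqP => [->|_]; case: eqP => [->|_] //=.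
    by rewrite orbF; case: (boolP (psi i0 \in A)) => // /disP /(_ pB).
  by case: (boolP (v \in B)) => // /(disP _ vA).
rewrite IH; first last.
- by move=> t w; rewrite !inE => /andP[_ tA] /andP[_ wB]; apply: cross.
- apply/fdisjointP => t; rewrite !inE => /andP[_ tA]; rewrite negb_and.
  by apply/orP; right; apply/negP => /(disP _ tA).
- by move: leA; rewrite (cardfsD1 v) vA.
rewrite [RHS](reindex_onto (fun S => i0 |: S) (fun S => S :\ i0)) /=; last first.
  move=> S /andP[_ /forallPn[i]]; rewrite negb_imply negbK -pv => /andP[iS /eqP/phi_inj ii].
  by rewrite setD1K // -ii.
apply: eq_big => [S|S _]; last by rewrite !eraseU1 pv.
apply/idP/idP => [/forall_inP ok|/andP[/andP[/forall_inP ok _] /eqP SE]].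
  have iS : i0 \notin S.
    by apply/negP => /ok; rewrite pv !inE eqxx.
  rewrite setU1K // eqxx andbT; apply/andP; split.
    apply/forall_inP => i /setU1P[->|/ok]; first by rewrite pv vA.
    by rewrite !inE => /andP[/andP[_ ->] /andP[_ ->]].
  by apply/forallPn; exists i0; rewrite setU11 pv eqxx.
apply/forall_inP => i iS.
have ii : i != i0 by move: iS; rewrite -SE !inE => /andP[].
have /andP[pA pB'] := ok i (setU1r i0 iS).
by rewrite !inE pA pB' -pv (inj_eq phi_inj) (inj_eq psi_inj) ii.
Qed.

End Cut.

(** * Trapezoids with unit dents *)

Lemma utri_fsetP (A B : {fset utri}) :
  (forall (o : bool) (i j : nat), ((o, (i, j)) \in A) = ((o, (i, j)) \in B)) -> A = B.
Proof. by move=> AB; apply/fsetP => -[o [i j]]; apply: AB. Qed.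

Lemma in_utriD1 (A : {fset utri}) (o o' : bool) (i j i' j' : nat) :
  ((o, (i, j)) \in A `\ (o', (i', j'))) =
  ~~ [&& o == o', i == i' & j == j'] && ((o, (i, j)) \in A).
Proof. by rewrite in_fsetD1 !xpair_eqE. Qed.

Lemma tilings_expand_down (R : {fset utri}) i j : (false, (i, j)) \in R ->
  tilings R =
    ((true, (i, j)) \in R) * tilings (R `\ (false, (i, j)) `\ (true, (i, j)))
  + ((true, (i.+1, j)) \in R) * tilings (R `\ (false, (i, j)) `\ (true, (i.+1, j)))
  + ((true, (i, j.+1)) \in R) * tilings (R `\ (false, (i, j)) `\ (true, (i, j.+1))).
Proof.
move=> vR; rewrite (tilings_expand vR).
pose s : seq utri := [:: (true, (i, j)); (true, (i.+1, j)); (true, (i, j.+1))].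
have us : uniq s by rewrite /= !inE !xpair_eqE /=; lia.
transitivity (\sum_(u <- s) (u \in R) * tilings (R `\ (false, (i, j)) `\ u)); last first.
  by rewrite !big_cons big_nil addn0 addnA.
rewrite [RHS](eq_bigr (fun u => if u \in R then tilings (R `\ (false, (i, j)) `\ u) else 0));
  last by move=> u _; case: (u \in R); rewrite ?mul1n ?mul0n.
have adj_s u : adj (false, (i, j)) u = (u \in s).
  by case: u => [[] [i' j']]; rewrite /s !inE !xpair_eqE /=; lia.
rewrite (eq_bigl _ _ adj_s) -[RHS]big_mkcond -[LHS]big_filter -[RHS]big_filter.
apply: perm_big; apply: uniq_perm; rewrite ?filter_uniq ?fset_uniq //.
by move=> u; rewrite !mem_filter andbC.
Qed.

Definition box (m n : nat) : seq utri :=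
  [seq (up, q) | up <- [:: true; false], q <- [seq (i, j) | i <- iota 0 m, j <- iota 0 n]].

Lemma mem_box m n (t : utri) : (t \in box m n) = (t.2.1 < m) && (t.2.2 < n).
Proof.
case: t => o [i j] /=.
apply/allpairsP/andP => [[[o' q] /= [_ /allpairsP[[i' j'] /= [hi hj ->]] [_ -> ->]]]|[hi hj]].
  by move: hi hj; rewrite !mem_iota.
exists (o, (i, j)); split => //; first by case: o.
by apply/allpairsP; exists (i, j); rewrite !mem_iota.
Qed.

(** The box only provides finiteness: for [trap], [swept] and [dtrap] the predicate implies the
    bounds, and their membership lemmas drop them. *)
Definition grid (M : nat) (p : pred utri) : {fset utri} := [fset t in box M M | p t].

Lemma mem_grid M p (t : utri) :
  (t \in grid M p) = [&& t.2.1 < M, t.2.2 < M & p t].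
Proof.
transitivity ((t \in box M M) && p t); first by rewrite !inE.
by rewrite mem_box andbA.
Qed.

Definition in_trap (N n : nat) (P : seq nat) : pred utri := fun t =>
  let: (up, (i, j)) := t in
  (j < n) && (if up then (i + j < N) && ~~ ((j == 0) && (i \in P)) else i + j + 1 < N).

Definition trap N n P := grid N (in_trap N n P).

Lemma mem_trap N n P up i j :
  ((up, (i, j)) \in trap N n P) = 
  (j < n) && (if up then (i + j < N) && ~~ ((j == 0) && (i \in P)) else i + j + 1 < N).
Proof. by rewrite mem_grid /=; case: up; lia. Qed.

(* A trapezoid with n + 1 rows whose bottom row has been tiled in the columns
   left of k; the up triangles in the positions W of the next row are used. *)
Definition in_swept N n k (P W : seq nat) : pred utri := fun t =>
  let: (up, (i, j)) := t in
  if j == 0 then (k <= i) && (if up then (i < N) && (i \notin P) else i + 1 < N)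
  else (j <= n) && (if up then (i + j < N) && ~~ ((j == 1) && (i \in W)) else i + j + 1 < N).

Definition swept N n k P W := grid N (in_swept N n k P W).

Lemma mem_swept N n k P W up i j :
  ((up, (i, j)) \in swept N n k P W) = 
  if j == 0 then (k <= i) && (if up then (i < N) && (i \notin P) else i + 1 < N)
  else (j <= n) && (if up then (i + j < N) && ~~ ((j == 1) && (i \in W)) else i + j + 1 < N).
Proof. by rewrite mem_grid /=; case: up; case: j => [|j] /=; lia. Qed.

Lemma trap_swept N n P : trap N n.+1 P = swept N n 0 P [::].
Proof.
by apply/fsetP => -[[] [i [|j]]]; rewrite mem_trap mem_swept /= ?in_nil ?addn0 ?andbF.
Qed.

Lemma adj_up0 k t : adj (true, (k, 0)) t ->
  t = (false, (k, 0)) \/ exists2 k', k = k'.+1 & t = (false, (k', 0)).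
Proof.
move: t => [[] [i j]] //=; rewrite orbF.
by case/andP => /eqP <- /orP[/eqP ->|/eqP ->]; [left | right; exists i].
Qed.

(** The left neighbour of the up triangle [(k, 0)] is already swept and nothing lies below it, so
    its partner is the down triangle on its right. *)
Lemma swept_forced N n k P W : k \notin P -> k.+1 < N ->
  tilings (swept N n k P W) = tilings (swept N n k.+1 P W).
Proof.
move=> kP kN; rewrite (@tilings_forced _ (true, (k, 0)) (false, (k, 0))).
- congr tilings; apply: utri_fsetP => o i j.
  rewrite !in_utriD1 !mem_swept; case: o; case: j => [|j] /=; lia.
- by rewrite mem_swept /=; lia.
- by rewrite mem_swept /=; lia.
- by rewrite /= !eqxx.
- move=> w wR /adj_up0[//|[k' kE wE]]; move: wR; rewrite wE mem_swept /=; lia.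
Qed.

Lemma swept_skip N n k k' P W : k <= k' -> k' < N -> (forall i, i < k' -> i \notin P) ->
  tilings (swept N n k P W) = tilings (swept N n k' P W).
Proof.
elim: k' => [|k' IH]; first by rewrite leqn0 => /eqP->.
rewrite leq_eqVlt => /orP[/eqP-> //|kk'] k'N h.
rewrite IH //; try lia; first by apply: swept_forced; rewrite ?h.
by move=> i ik; apply: h; lia.
Qed.

(** Without dents every step is forced up to the last up triangle of the row, which is left without
    a partner. *)
Lemma swept_nil N n k W : k < N -> tilings (swept N n k [::] W) = 0.
Proof.
move=> kN; rewrite (@swept_skip _ _ _ N.-1); try lia; last by move=> i; rewrite in_nil.
apply: (@tilings_stuck _ (true, (N.-1, 0))); first by rewrite mem_swept /= ?in_nil; lia.
move=> w wR; apply/negP => /adj_up0 [wE|[k' kE wE]];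
  move: wR; rewrite wE mem_swept /=; lia.
Qed.

(** At a dent, the down triangle [(p, 0)] has lost its left neighbour. Pairing it to the right moves
    the dent to [p.+1]; pairing it upwards turns [p] into a dent of the next row, which exists iff
    [0 < n]. *)
Lemma swept_step N n p (ps W : seq nat) : p.+1 < N -> p \notin W ->
  tilings (swept N n p (p :: ps) W) =
  (p.+1 \notin ps) * tilings (swept N n p.+1 (p.+1 :: ps) W)
  + (0 < n) * tilings (swept N n p.+1 ps (rcons W p)).
Proof.
move=> pN pW; rewrite (@tilings_expand_down _ p 0); last by rewrite mem_swept /=; lia.
rewrite !mem_swept /= !inE eqxx /= !andbF mul0n add0n.
congr (_ + _); congr (nat_of_bool _ * tilings _).
- by rewrite leqnSn pN gtn_eqF.
- apply: utri_fsetP => o i j; rewrite !in_utriD1 !mem_swept !inE.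
  case: o; case: j => [|j] /=; lia.
- by rewrite pW addn1 pN !andbT.
- apply: utri_fsetP => o i j; rewrite !in_utriD1 !mem_swept !inE mem_rcons !inE.
  case: o; case: j => [|j] /=; case: (i \in ps); case: (i \in W); lia.
Qed.

(** A dent in the last cell exhausts the bottom row; the remaining rows move down by one. *)
Lemma swept_last N n W : 0 < N ->
  tilings (swept N n N.-1 [:: N.-1] W) = tilings (trap N.-1 n W).
Proof.
case: N => // N _ /=.
apply: (@tilings_iso (fun t => (t.1, (t.2.1, t.2.2.-1))) (fun t => (t.1, (t.2.1, t.2.2.+1)))).
- move=> [o [i [|j]]]; rewrite mem_swept /=; first by case: o; rewrite ?inE => h; exfalso; lia.
  by rewrite mem_trap => h; split => //; move: h; case: o; case: (i \in W); lia.
- move=> [o [i j]]; rewrite mem_trap mem_swept /= => h; split => //.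
  by move: h; case: o; case: (i \in W); lia.
- move=> [o [i [|j]]] [o' [i' [|j']]]; rewrite !mem_swept /=; case: o; case: o';
    by rewrite ?inE /= => h1 h2; lia.
Qed.

(** * Tilings of a trapezoid as a determinant of binomial coefficients *)

Section ListDeterminant.

Import GRing.Theory.
Local Open Scope ring_scope.

(** Rows are kept in a list so that changing one row is a concatenation, matching the way the sweep
    changes [W] and [ps]. *)
Definition list_det (n : nat) (l : seq (nat -> rat)) : rat :=
  \det (\matrix_(i < n, j < n) nth (fun=> 0) l i j).

Lemma list_det_linear n (l1 l2 : seq (nat -> rat)) (r r1 r2 : nat -> rat) :
  (size l1 < n)%N -> (forall j, r j = r1 j - r2 j) ->
  list_det n (l1 ++ r :: l2) = list_det n (l1 ++ r1 :: l2) - list_det n (l1 ++ r2 :: l2).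
Proof.
move=> ln rE; pose i0 := Ordinal ln.
rewrite -[in RHS](mul1r (list_det n (l1 ++ r1 :: l2))) -[X in _ - X]mul1r -mulNr.
apply: (determinant_multilinear (i0 := i0)).
- by apply/rowP => j; rewrite !mxE /= !nth_cat ltnn subnn /= rE mul1r mulN1r.
- apply/matrixP => i j; rewrite !mxE /= !nth_cat; case: ltngtP => // h.
    by case: (_ - _)%N (subn_gt0 (size l1) (bump (size l1) i)) => //; rewrite h.
  by have := neq_bump (size l1) i; rewrite h eqxx.
- apply/matrixP => i j; rewrite !mxE /= !nth_cat; case: ltngtP => // h.
    by case: (_ - _)%N (subn_gt0 (size l1) (bump (size l1) i)) => //; rewrite h.
  by have := neq_bump (size l1) i; rewrite h eqxx.
Qed.

Lemma list_det_alternate n (l1 l2 : seq (nat -> rat)) r :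
  ((size l1).+1 < n)%N -> list_det n (l1 ++ r :: r :: l2) = 0.
Proof.
move=> ln; have ln' := ltnW ln.
rewrite /list_det (determinant_alternate (i1 := Ordinal ln') (i2 := Ordinal ln)) //.
  by rewrite -val_eqE /= neq_ltn ltnSn.
move=> j; rewrite !mxE /= !nth_cat ltnn subnn ltnNge leqnSn /=.
by rewrite subSn // subnn.
Qed.

Definition binrow (p j : nat) : rat := 'C(p, j)%:R.

(** The row of a dent already passed on to the next row of the trapezoid: the binomial row preceded
    by a zero column. *)
Definition shift_binrow (p j : nat) : rat := if j is j'.+1 then 'C(p, j')%:R else 0.

Lemma binrowS p j : shift_binrow p j = binrow p.+1 j - binrow p j.
Proof.
by case: j => [|j]; rewrite /binrow /= ?bin0 ?subrr // binS natrD addrAC subrr add0r.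
Qed.

Definition bindet (P : seq nat) : rat := list_det (size P) (map binrow P).

(* Only the last row has a non-zero entry in the first column. *)
Lemma list_det_shift (W : seq nat) p :
  list_det (size W).+1 (map shift_binrow W ++ [:: binrow p]) = (-1) ^+ size W * bindet W.
Proof.
rewrite /list_det (expand_det_col _ ord0) (bigD1 ord_max) //= big1 ?addr0 => [|i iN].
  rewrite mxE /= nth_cat size_map ltnn subnn /= /binrow bin0 mul1r /cofactor /= addn0.
  congr (_ * \det _); apply/matrixP => i j; rewrite !mxE /= /bump leqNgt ltn_ord add0n.
  by rewrite nth_cat size_map ltn_ord !(nth_map 0%N).
have iW : (i < size W)%N.
  by have := ltn_ord i; rewrite ltnS leq_eqVlt => /orP[/eqP iE|//];
     move: iN; rewrite -val_eqE /= iE eqxx.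
by rewrite mxE /= nth_cat size_map iW (nth_map 0%N) // mul0r.
Qed.

(* As [binrow p.+1 - binrow p = shift_binrow p], linearity in the row of [p]
   gives the determinant the recurrence [swept_step]; its term with [p.+1]
   vanishes exactly when [p.+1] is already a dent, having two equal rows. *)
Lemma tilings_swept N n W p ps :
  (forall W', size W' = n -> pairwise ltn W' -> all (gtn N.-1) W' ->
     (tilings (trap N.-1 n W'))%:R = bindet W') ->
  pairwise ltn (W ++ p :: ps) -> all (gtn N) (W ++ p :: ps) ->
  (size W + size ps)%N = n ->
  (tilings (swept N n p (p :: ps) W))%:R =
    (-1) ^+ size W * list_det n.+1 (map shift_binrow W ++ map binrow (p :: ps)).
Proof.
move=> CLP; have [m] := ubnP (N - p)%N; elim: m W p ps => // m IH W p ps leN.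
move=> inc bd sz.
have pN : (p < N)%N by move: bd; rewrite all_cat /= => /and3P[].
have [Wp incW incp] : [/\ (forall w, w \in W -> w < p)%N, pairwise ltn W & pairwise ltn (p :: ps)].
  move: inc; rewrite pairwise_cat => /and3P[/allrelP h -> ->]; split => // w wW.
  by apply: h; rewrite ?inE ?eqxx.
have [pN1|pN1] := leqP N p.+1.
  have ps0 : ps = [::].
    case: ps bd incp {inc sz} => // q ps; rewrite all_cat /= => /and4P[_ _ qN _] /andP[/andP[pq _] _].
    by move: qN; rewrite /gtn /= in pq *; lia.
  have pE : p = N.-1 by lia.
  move: sz; rewrite ps0 /= addn0 => sz.
  rewrite pE swept_last; last lia.
  rewrite CLP // -?sz; last first.
    by apply/allP => w /Wp; rewrite pE.
  (* The cofactor sign cancels the sign in the statement. *)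
  by rewrite list_det_shift mulrA -exprMn mulrNN mulr1 expr1n mul1r.
have pW : p \notin W by apply/negP => /Wp; rewrite ltnn.
rewrite swept_step // natrD !natrM.
case: ps => [|q ps] in inc bd sz incp *.
  (* Sending the last dent upwards leaves a row that cannot be completed, so it must move right;
     accordingly [list_det_shift] gives the same value for the last rows [p] and [p.+1]. *)
  rewrite (@swept_nil _ _ p.+1) // mulr0 addr0 mul1r IH; last first.
  - by [].
  - by move: bd; rewrite !all_cat /= => /and3P[-> _ _]; rewrite /gtn /= pN1.
  - rewrite pairwise_cat incW /= !andbT; apply/allrelP => w x /Wp wp; rewrite inE => /eqP ->.
    by rewrite /= ltnW.
  - lia.
  by move: sz; rewrite /= addn0 => <-; rewrite !list_det_shift.
have pq : (p < q)%N by move: incp => /= /andP[/andP[]].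
have qps x : x \in ps -> (q < x)%N.
  by move: incp => /= /and3P[_ /allP h _] /h.
have qN : (q < N)%N by move: bd; rewrite all_cat /= => /and4P[].
have -> : (0 < n)%N by move: sz => /=; lia.
rewrite mul1r (@swept_skip _ _ p.+1 q (q :: ps)) //; last first.
  move=> i iq; rewrite inE negb_or neq_ltn iq /=.
  by apply/negP => /qps; lia.
rewrite (IH (rcons W p) q ps); last first.
- by move: sz; rewrite size_rcons /=; lia.
- by rewrite cat_rcons.
- by rewrite cat_rcons.
- lia.
rewrite map_rcons cat_rcons size_rcons exprS mulN1r mulNr.
rewrite [in RHS](@list_det_linear _ _ _ (binrow p) (binrow p.+1) (shift_binrow p)); first last.
- by move=> j; rewrite binrowS opprB addrCA subrr addr0.
- by rewrite size_map; move: sz => /=; lia.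
rewrite mulrBr; congr (_ - _).
have [qE|qE] := eqVneq q p.+1.
  rewrite qE inE eqxx mul0r /= list_det_alternate ?mulr0 // size_map; move: sz => /=; lia.
have -> : p.+1 \notin q :: ps.
  by rewrite inE negb_or eq_sym qE /=; apply/negP => /qps; lia.
rewrite mul1r IH //; last first.
- move: bd; rewrite !all_cat /= => /and4P[-> _ -> ->]; rewrite /gtn /= pN1 //.
- rewrite pairwise_cat incW /=; move: incp => /= /andP[_ ->]; rewrite andbT.
  apply/andP; split.
    move: inc; rewrite pairwise_cat => /and3P[/allrelP h _ _].
    apply/allrelP => w x wW; rewrite inE => /orP[/eqP->|xq]; first by have := Wp w wW => /=; lia.
    by apply: h; rewrite // inE xq orbT.
  have p1q : (p.+1 < q)%N by lia.
  by rewrite /= p1q /=; apply/allP => x /qps /=; lia.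
- lia.
Qed.

Lemma tilings_trap_det n N (P : seq nat) :
  size P = n -> pairwise ltn P -> all (gtn N) P -> (tilings (trap N n P))%:R = bindet P.
Proof.
elim: n N P => [|n IH] N P.
  move=> /size0nil -> _ _; rewrite (_ : trap N 0 [::] = fset0%fset).
    by rewrite tilings0 /bindet /list_det det_mx00.
  by apply: utri_fsetP => o i j; rewrite mem_trap.
case: P => // p ps [sz] inc bd; rewrite trap_swept.
have pN : (p < N)%N by case/andP: bd.
rewrite (@swept_skip _ _ _ p) //; last first.
  move=> i ip; rewrite inE negb_or; apply/andP; split; first by rewrite neq_ltn ip.
  by move: inc => /= /andP[/allP h _]; apply/negP => /h /=; lia.
rewrite tilings_swept // ?expr0 ?mul1r ?sz; last by move=> W'; apply: IH.
by rewrite /bindet /= sz.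
Qed.

End ListDeterminant.

(** * Vandermonde products *)

Definition dist (m n : nat) : nat := (m - n) + (n - m).

(** Absolute differences keep the Vandermonde product in [nat] and make it independent of the order,
    so lists of dents need not be sorted. *)
Fixpoint vdm (s : seq nat) : nat :=
  if s is p :: s' then (\prod_(q <- s') dist p q) * vdm s' else 1.

Lemma distC m n : dist m n = dist n m. Proof. exact: addnC. Qed.

Lemma dist_add k m n : dist (k + m) (k + n) = dist m n.
Proof. by rewrite /dist !subnDl. Qed.

Section Vandermonde.

Import GRing.Theory Num.Theory.
Local Open Scope ring_scope.

Definition fallpoly (j : nat) : {poly rat} := \prod_(k < j) ('X - (k%:R)%:P).

Lemma fallpoly_eval j p : (fallpoly j).[p%:R] = (p ^_ j)%:R.
Proof.
rewrite /fallpoly; elim: j => [|j IH]; first by rewrite big_ord0 hornerC.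
rewrite big_ord_recr hornerM IH hornerXsubC ffactnSr natrM /=.
have [jp|pj] := leqP j p; first by rewrite natrB.
by rewrite ffact_small // !mul0r.
Qed.

(** [fallpoly j] is monic of degree j, so its coefficients form a triangular matrix [U] with unit
    diagonal, and the matrix is the transpose of [U] times a Vandermonde matrix. *)
Lemma vandermonde_fall (P : seq nat) : let n := size P in
  \det (\matrix_(i < n, j < n) ((nth 0%N P i) ^_ j)%:R : 'M[rat]_n) =
  \prod_(i < n) \prod_(j < n | (i < j)%N) ((nth 0%N P j)%:R - (nth 0%N P i)%:R).
Proof.
move=> n; pose a : 'rV[rat]_n := \row_j (nth 0%N P j)%:R.
pose U : 'M[rat]_n := \matrix_(j, k) (fallpoly j)`_k.
have sz (j : nat) : size (fallpoly j) = j.+1.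
  by rewrite /fallpoly size_prod_XsubC /index_enum -enumT size_enum_ord.
have -> : \matrix_(i < n, j < n) ((nth 0%N P i) ^_ j)%:R = (U *m Vandermonde n a)^T.
  apply/matrixP => i j; rewrite !mxE -fallpoly_eval.
  rewrite (horner_coef_wide (n := n)); last by rewrite sz.
  by apply: eq_bigr => k _; rewrite !mxE.
rewrite det_tr det_mulmx det_Vandermonde det_trig; last first.
  by apply/is_trig_mxP => i j ij; rewrite mxE nth_default // sz.
rewrite big1 ?mul1r => [|i _]; last first.
  rewrite mxE.
  have := monicP (monic_prod_XsubC (index_enum (ordinal i)) xpredT (fun k : 'I_i => k%:R : rat)).
  by rewrite lead_coefE -/(fallpoly i) sz.
by apply: eq_bigr => i _; apply: eq_bigr => j _; rewrite !mxE.
Qed.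

Lemma prod_diff_vdm (P : seq nat) : pairwise ltn P ->
  \prod_(i < size P) \prod_(j < size P | (i < j)%N)
     ((nth 0%N P j)%:R - (nth 0%N P i)%:R : rat) = (vdm P)%:R.
Proof.
elim: P => [|p P IH]; first by rewrite big_ord0.
move=> /= /andP[/allP pP incP]; rewrite big_ord_recl natrM -IH // natr_prod; congr (_ * _).
  rewrite (big_nth 0%N) big_mkord big_mkcond big_ord_recl /= mul1r; apply: eq_bigr => j _.
  have /= h := pP _ (mem_nth 0%N (ltn_ord j)).
  rewrite -natrB 1?ltnW //; congr _%:R; rewrite /dist.
  by move: (nth 0%N P j) h => x h; lia.
apply: eq_bigr => i _; rewrite big_mkcond big_ord_recl /= mul1r [RHS]big_mkcond.
by apply: eq_bigr => j _.
Qed.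

(** Scaling column j by j! turns binomials into falling factorials; the product of these factors is
    the hyperfactorial. *)
Lemma bindet_vdm (P : seq nat) : pairwise ltn P ->
  bindet P * (hyperfact (size P))%:R = (vdm P)%:R.
Proof.
move=> incP; rewrite -prod_diff_vdm // -vandermonde_fall /bindet /list_det.
pose d : 'rV[rat]_(size P) := \row_j (j`!)%:R.
rewrite (_ : (hyperfact _)%:R = \det (diag_mx d)); last first.
  by rewrite det_diag /hyperfact natr_prod; apply: eq_bigr => i _; rewrite mxE.
rewrite -det_mulmx; congr (\det _); apply/matrixP => i j.
rewrite mul_mx_diag !mxE (nth_map 0%N) // /binrow -natrM.
by rewrite bin_ffact.
Qed.

Lemma tilings_trap_sorted N (P : seq nat) :
  pairwise ltn P -> all (gtn N) P ->
  (tilings (trap N (size P) P) * hyperfact (size P))%N = vdm P.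
Proof.
move=> incP bd; apply/eqP; rewrite -(eqr_nat rat) natrM tilings_trap_det //.
by rewrite bindet_vdm.
Qed.

End Vandermonde.

Lemma vdm_perm s1 s2 : perm_eq s1 s2 -> vdm s1 = vdm s2.
Proof.
have sw p q s : vdm (p :: q :: s) = vdm (q :: p :: s).
  by rewrite /= !big_cons (distC q p); nia.
have rot1 p s t : vdm (s ++ p :: t) = vdm (p :: s ++ t).
  elim: s => //= q s IH; rewrite -/(vdm (p :: q :: s ++ t)) -sw /= IH /=; congr (_ * _).
  by rewrite !big_cat !big_cons /= mulnCA big_cat.
elim: s1 s2 => [|p s1 IH] s2 p12.
  by move: p12; rewrite perm_sym => /perm_nilP ->.
have ps2 : p \in s2 by rewrite -(perm_mem p12) inE eqxx.
move: p12; case/splitPr: ps2 => s t; rewrite perm_sym (perm_catCA s [:: p] t) /= perm_cons.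
move=> p12; rewrite rot1 /= (IH (s ++ t)); last by rewrite perm_sym.
by rewrite (perm_big _ p12).
Qed.

Lemma vdm_cat s t : vdm (s ++ t) = vdm s * vdm t * \prod_(p <- s) \prod_(q <- t) dist p q.
Proof.
elim: s => [|p s IH] /=; first by rewrite big_nil mul1n muln1.
by rewrite IH big_cat big_cons /=; nia.
Qed.

Lemma vdm_shift k s : vdm (map (addn k) s) = vdm s.
Proof.
elim: s => //= p s ->; congr (_ * _); rewrite big_map.
by apply: eq_bigr => q _; rewrite dist_add.
Qed.

Lemma trap_eq_mem N n (P Q : seq nat) : P =i Q -> trap N n P = trap N n Q.
Proof. by move=> PQ; apply: utri_fsetP => o i j; rewrite !mem_trap PQ. Qed.

Lemma tilings_trap N (P : seq nat) : uniq P -> all (gtn N) P ->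
  tilings (trap N (size P) P) * hyperfact (size P) = vdm P.
Proof.
move=> uP bd; have pP : perm_eq (sort leq P) P by rewrite perm_sort.
rewrite -(vdm_perm pP) -(perm_size pP) -(trap_eq_mem _ _ (perm_mem pP)).
apply: tilings_trap_sorted; last by rewrite (perm_all _ pP).
rewrite -sorted_pairwise; last exact: ltn_trans.
by rewrite ltn_sorted_uniq_leq sort_uniq uP sort_sorted //; apply: leq_total.
Qed.

Lemma vdm_iota m n : vdm (iota m n) = hyperfact n.
Proof.
elim: n m => [|n IH] m; first by rewrite /hyperfact big_ord0.
rewrite /= IH /hyperfact big_ord_recr /= mulnC; congr (_ * _).
rewrite -[m.+1]addn1 iotaDl big_map fact_prod big_add1 /= /index_iota subn0.
by rewrite -[1]addn0 iotaDl big_map; apply: eq_bigr => i _; rewrite /dist; lia.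
Qed.

Lemma count_trap N n (P : seq nat) : 0 < n -> uniq P -> all (gtn N) P ->
  count_up (trap N n P) + size P = count_up (trap N n [::]) /\
  count_down (trap N n P) = count_down (trap N n [::]).
Proof.
move=> n0; elim: P => [|p P IH] /=; first by rewrite addn0.
case/andP => pP uP /andP[/= pN bd]; have [<- <-] := IH uP bd.
have mem : (true, (p, 0)) \in trap N n P by rewrite mem_trap n0 addn0 pN pP.
rewrite (count_upD1 mem) (count_downD1 mem) /= add0n addnS addSn.
suff -> : trap N n (p :: P) = trap N n P `\ (true, (p, 0)) by [].
apply: utri_fsetP => o i j; rewrite in_utriD1 !mem_trap inE.
by case: o => /=; case: (i \in P); lia.
Qed.

(** The triangles of the trapezoid are not counted explicitly: the dents [iota 0 n] leave a
    tileable, hence balanced, region, and comparison with it shows that any other number of dents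
    breaks the balance. *)
Lemma tilings_trap_unbalanced N n (P : seq nat) : 0 < n <= N -> uniq P -> all (gtn N) P ->
  size P != n -> tilings (trap N n P) = 0.
Proof.
move=> /andP[n0 nN] uP bd; apply: contraNeq => /tilings_balanced bal.
have bd0 : all (gtn N) (iota 0 n).
  by apply/allP => i; rewrite mem_iota /= => h; lia.
have := tilings_trap (iota_uniq 0 n) bd0; rewrite size_iota vdm_iota => t1.
have h0 : hyperfact n != 0.
  by rewrite -lt0n /hyperfact prodn_gt0 // => i; apply: fact_gt0.
have /tilings_balanced bal0 : tilings (trap N n (iota 0 n)) != 0.
  by apply: contraNneq h0 => t0; rewrite -t1 t0 mul0n.
have [u1 d1] := count_trap n0 uP bd; have [u0 d0] := count_trap n0 (iota_uniq 0 n) bd0.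
by move: u0; rewrite size_iota => u0; apply/eqP; lia.
Qed.

(** * Removing large triangles *)

(* A pair (p, s) stands for the up-pointing triangle of side s whose base
   starts at (p, 0). *)
Definition in_tri (t : utri) (q : nat * nat) : bool :=
  let: (up, (i, j)) := t in
  (q.1 <= i) && (if up then i + j < q.1 + q.2 else i + j + 1 < q.1 + q.2).

Definition bases (L : seq (nat * nat)) : seq nat := flatten [seq iota q.1 q.2 | q <- L].

Lemma in_tri_base o i j (q : nat * nat) : in_tri (o, (i, j)) q -> i \in iota q.1 q.2.
Proof. by rewrite mem_iota /=; case: o; lia. Qed.

Lemma mem_bases L q i : q \in L -> i \in iota q.1 q.2 -> i \in bases L.
Proof. by move=> qL iq; apply/flattenP; exists (iota q.1 q.2) => //; apply: map_f. Qed.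

Lemma has_in_tri_base o i j L : has (in_tri (o, (i, j))) L -> i \in bases L.
Proof. by case/hasP => q qL /in_tri_base; apply: mem_bases. Qed.

Definition dtrap N n P L := grid N (fun t => in_trap N n P t && ~~ has (in_tri t) L).

Lemma mem_dtrap N n P L up i j :
  ((up, (i, j)) \in dtrap N n P L) = [&& j < n,
    if up then (i + j < N) && ~~ ((j == 0) && (i \in P)) else i + j + 1 < N
    & ~~ has (in_tri (up, (i, j))) L].
Proof. by rewrite mem_grid /= -andbA; case: (has _ _) => /=; case: up; lia. Qed.

(** This is a translated trapezoid with s rows and dents [iota 0 s], whose Vandermonde product
    equals the hyperfactorial it is divided by. *)
Lemma tilings_triangle p s N : p + s <= N ->
  tilings (grid N (fun t => in_tri t (p, s) && ~~ (t.1 && (t.2.2 == 0)))) = 1.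
Proof.
move=> psN; have h0 : 0 < hyperfact s by rewrite prodn_gt0 // => i; apply: fact_gt0.
have bd : all (gtn s) (iota 0 s) by apply/allP => i; rewrite mem_iota /=; lia.
have := tilings_trap (iota_uniq 0 s) bd; rewrite size_iota vdm_iota => t1.
suff -> : tilings (grid N (fun t => in_tri t (p, s) && ~~ (t.1 && (t.2.2 == 0)))) =
  tilings (trap s s (iota 0 s)).
  by apply/eqP; rewrite -(eqn_pmul2r h0) t1 mul1n.
apply: (@tilings_iso (fun t => (t.1, (t.2.1 - p, t.2.2))) (fun t => (t.1, (t.2.1 + p, t.2.2)))).
- move=> [o [i j]]; rewrite mem_grid mem_trap mem_iota /= => h.
  split; first by move: h; case: o => /=; lia.
  by rewrite subnK //; lia.
- move=> [o [i j]]; rewrite mem_grid mem_trap mem_iota /= => h.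
  split; first by move: h; case: o => /=; lia.
  by rewrite addnK.
- move=> [o [i j]] [o' [i' j']]; rewrite !mem_grid /= => h h'.
  by move: h h'; case: o; case: o' => //=; lia.
Qed.

(** Once the unit triangles along the base of [q] are removed, the down triangles in the rest [T] of
    [q] have no neighbour outside [T]. So [T] splits off, and it has a single tiling: a large
    removed triangle amounts to a row of unit dents. *)
Lemma dtrap_fill N n P q L : uniq (bases (q :: L)) -> q.1 + q.2 <= N -> q.2 <= n ->
  tilings (dtrap N n P (q :: L)) = tilings (dtrap N n (iota q.1 q.2 ++ P) L).
Proof.
case: q => p s /=; rewrite cat_uniq => /and3P[_ /hasPn dis _] psN sn.
have sep o i j : in_tri (o, (i, j)) (p, s) -> ~~ has (in_tri (o, (i, j))) L.
  move=> /in_tri_base ip; apply/negP => /has_in_tri_base /dis.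
  by rewrite ip.
have tri1 := tilings_triangle psN.
set T := grid N _ in tri1.
have mT o i j : ((o, (i, j)) \in T) =
    [&& i < N, j < N, in_tri (o, (i, j)) (p, s) & ~~ (o && (j == 0))].
  by rewrite mem_grid.
rewrite [RHS](@tilings_split_off _ T).
- rewrite tri1 mul1n; congr tilings; apply: utri_fsetP => o i j.
  rewrite in_fsetD mT !mem_dtrap mem_cat mem_iota /=.
  by case: (has _ _) => /=; rewrite ?orbT ?andbF //; case: (i \in P); case: o => /=; lia.
- apply/fsubsetP => -[o [i j]]; rewrite mT => /and4P[iN jN tri nb].
  rewrite mem_dtrap (sep _ _ _ tri) andbT mem_cat mem_iota; move: tri nb => /=.
  by case: (i \in P); case: o => /=; lia.
- by apply: tilings_balanced; rewrite tri1.
- move=> [o [i j]] [o' [i' j']]; rewrite !mT mem_dtrap mem_cat mem_iota /=.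
  by case: o; case: o' => //=; case: (i' \in P); case: (has _ _) => //=; lia.
Qed.

Lemma dtrap_trap N n P L : uniq (bases L) ->
  all (fun q => (q.1 + q.2 <= N) && (q.2 <= n)) L ->
  tilings (dtrap N n P L) = tilings (trap N n (P ++ bases L)).
Proof.
elim: L P => [|q L IH] P uL bd.
  rewrite cats0; congr tilings; apply: utri_fsetP => o i j.
  by rewrite mem_dtrap mem_trap /= andbT.
case/andP: bd => /andP[qN qn] bd; rewrite dtrap_fill // IH //; last first.
  by move: uL; rewrite /bases /= cat_uniq => /and3P[].
congr tilings; apply: trap_eq_mem => i; rewrite /bases /= !mem_cat.
by case: (i \in iota _ _); case: (i \in P).
Qed.

Section DentedTrapezoid.

Variables (N n : nat) (P : seq nat) (L : seq (nat * nat)).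
Hypotheses (uPL : uniq (P ++ bases L)) (bdP : all (gtn N) P).
Hypothesis bdL : all (fun q => (q.1 + q.2 <= N) && (q.2 <= n)) L.

Let bdPL : all (gtn N) (P ++ bases L).
Proof.
rewrite all_cat bdP; apply/allP => i /flattenP[_ /mapP[q qL ->]].
by rewrite mem_iota; have := allP bdL q qL => /=; lia.
Qed.

Lemma tilings_dtrap : size P + size (bases L) = n ->
  tilings (dtrap N n P L) * hyperfact n = vdm (P ++ bases L).
Proof.
rewrite -size_cat => sz; rewrite dtrap_trap //; last by move: uPL; rewrite cat_uniq => /and3P[].
by rewrite -sz tilings_trap.
Qed.

Lemma tilings_dtrap_unbalanced : 0 < n <= N -> size P + size (bases L) != n ->
  tilings (dtrap N n P L) = 0.
Proof.
rewrite -size_cat => nN sz; rewrite dtrap_trap //; last by move: uPL; rewrite cat_uniq => /and3P[].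
exact: tilings_trap_unbalanced.
Qed.

End DentedTrapezoid.

(** * Cutting along a horizontal line *)

Lemma mem_dtrap_dents N n P L (o : bool) (i j : nat) :
  ((o, (i, j)) \in dtrap N n P L) =
  ((o, (i, j)) \in dtrap N n [::] L) && ~~ [&& o, j == 0 & i \in P].
Proof.
rewrite !mem_dtrap in_nil; case: (has _ _); rewrite /= ?andbF //.
by case: (i \in P); case: o => /=; lia.
Qed.

(* The region [R] is cut along the horizontal line at level [l].  The part above
   the line is a trapezoid of base [N1] with the triangles [L1] removed; the
   reflection [(i, j) -> (i + j - sw, l - j)] in the line turns the part below
   it into a trapezoid of base [N2] with the triangles [L2] removed.  The
   lozenges crossing the line sit at the positions [pos k]. *)
Section HorizontalCut.

Variables (R : {fset utri}) (K : nat) (pos : 'I_K -> nat) (l sw N1 n1 N2 z : nat).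
Variables (L1 L2 : seq (nat * nat)).

Hypothesis pos_inj : injective pos.
Hypothesis above : forall (o : bool) (i j : nat),
  ((o, (i, j + l)) \in R) = ((o, (i, j)) \in dtrap N1 n1 [::] L1).
Hypothesis below_left : forall (o : bool) (i j : nat),
  (o, (i, j)) \in R -> j < l -> sw <= i + j + ~~ o.
(** Reflection exchanges orientations. The term [~~ o] locates the left corner of a reflected down
    triangle, and [l.-1] appears because row j of triangles lies between levels j and j + 1. *)
Hypothesis below : forall (o : bool) (i j : nat), j < l -> sw <= i + j + ~~ o ->
  ((o, (i, j)) \in R) = ((~~ o, (i + j + ~~ o - sw, l.-1 - j)) \in dtrap N2 l [::] L2).
(** Makes the subtractions in the inverse reflection exact. *)
Hypothesis dtrap_left : forall (o : bool) (i j : nat),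
  (o, (i, j)) \in dtrap N2 l [::] L2 -> l + o <= i + j + sw + 1.
Hypothesis cells : forall p : nat, 0 < l -> (true, (p, l)) \in R -> (false, (p, l.-1)) \in R ->
  exists k, p = pos k.
Hypothesis pos_above : forall k, (pos k < N1) && (pos k \notin bases L1).
Hypothesis pos_below : forall k,
  [&& sw <= pos k + l, pos k + l - sw < N2 & pos k + l - sw \notin bases L2].
Hypotheses (uL1 : uniq (bases L1)) (uL2 : uniq (bases L2)).
Hypothesis bdL1 : all (fun q => (q.1 + q.2 <= N1) && (q.2 <= n1)) L1.
Hypothesis bdL2 : all (fun q => (q.1 + q.2 <= N2) && (q.2 <= l)) L2.
Hypotheses (n1E : n1 = z + size (bases L1)) (lE : l = z + size (bases L2)).
Hypotheses (n1N : n1 <= N1) (lN : l <= N2).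

Let phi (k : 'I_K) : utri := (true, (pos k, l)).
Let psi (k : 'I_K) : utri := (false, (pos k, l.-1)).
Let A := [fset t in R | l <= t.2.2].
Let B := [fset t in R | t.2.2 < l].
Let pos1 (S : {set 'I_K}) := [seq pos k | k <- enum S].
Let pos2 (S : {set 'I_K}) := [seq pos k + l - sw | k <- enum S].

Let phiE (S : {set 'I_K}) (o : bool) (i j : nat) :
  [exists k in S, phi k == (o, (i, j))] = [&& o, j == l & i \in pos1 S].
Proof.
apply/existsP/and3P => [[k /andP[kS /eqP[<- <- <-]]]|[oE /eqP jE /mapP[k kS iE]]].
  by split => //; apply: map_f; rewrite mem_enum.
by exists k; rewrite -mem_enum kS /phi oE jE iE eqxx.
Qed.

Let psiE (S : {set 'I_K}) (o : bool) (i j : nat) :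
  [exists k in S, psi k == (o, (i, j))] = [&& ~~ o, j == l.-1 & i \in pos1 S].
Proof.
apply/existsP/and3P => [[k /andP[kS /eqP[<- <- <-]]]|[/negbTE oE /eqP jE /mapP[k kS iE]]].
  by split => //; apply: map_f; rewrite mem_enum.
by exists k; rewrite -mem_enum kS /psi oE jE iE eqxx.
Qed.

Let pos12 (S : {set 'I_K}) (i : nat) : sw <= i + l -> (i + l - sw \in pos2 S) = (i \in pos1 S).
Proof.
move=> swi; apply/mapP/mapP => -[k kS iE]; exists k => //; last by rewrite iE.
by have /and3P[h _ _] := pos_below k; lia.
Qed.

Let memA (o : bool) (i j : nat) : ((o, (i, j)) \in A) = ((o, (i, j)) \in R) && (l <= j).
Proof. by rewrite !inE. Qed.

Let memB (o : bool) (i j : nat) : ((o, (i, j)) \in B) = ((o, (i, j)) \in R) && (j < l).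
Proof. by rewrite !inE. Qed.

Let tilings_above (S : {set 'I_K}) : tilings (erase phi A S) = tilings (dtrap N1 n1 (pos1 S) L1).
Proof.
apply: (@tilings_iso (fun t => (t.1, (t.2.1, t.2.2 - l))) (fun t => (t.1, (t.2.1, t.2.2 + l)))).
- move=> [o [i j]]; rewrite in_erase memA phiE => /andP[/andP[tR lj] nS] /=.
  rewrite subnK //; split => //; rewrite mem_dtrap_dents -above subnK // tR /=.
  by apply: contra nS; case: o {tR} => //=; case: (i \in _) => //=; lia.
- move=> [o [i j]]; rewrite mem_dtrap_dents -above => /andP[tR nS] /=.
  rewrite addnK; split => //; rewrite in_erase memA phiE tR leq_addl /=.
  by apply: contra nS; case: o {tR} => //=; case: (i \in _) => //=; lia.
- move=> [o [i j]] [o' [i' j']]; rewrite !in_erase !memA => /andP[/andP[_ h] _] /andP[/andP[_ h'] _].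
  by case: o; case: o' => //=; lia.
Qed.

Let tilings_below (S : {set 'I_K}) : tilings (erase psi B S) = tilings (dtrap N2 l (pos2 S) L2).
Proof.
apply: (@tilings_iso (fun t => (~~ t.1, (t.2.1 + t.2.2 + ~~ t.1 - sw, l.-1 - t.2.2)))
                     (fun t => (~~ t.1, (t.2.1 + sw - (l.-1 - t.2.2) - t.1, l.-1 - t.2.2)))).
- move=> [o [i j]]; rewrite in_erase memB psiE => /andP[/andP[tR jl] nS] /=.
  have lo := below_left tR jl.
  split; last by rewrite negbK; congr (_, (_, _)); lia.
  rewrite mem_dtrap_dents -below // tR /=; apply: contra nS => /and3P[o0 jE].
  rewrite o0; have -> : j = l.-1 by lia.
  rewrite eqxx /=; case: o o0 lo {tR} => //= _ lo.
  by rewrite -[_ + _ + _]addnA (_ : l.-1 + 1 = l) ?pos12 //; lia.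
- move=> [o [i j]]; rewrite mem_dtrap_dents => /andP[tD nS] /=.
  have lo := dtrap_left tD.
  have jl : j < l by move: tD; rewrite mem_dtrap => /andP[].
  set i' := i + sw - _ - _; set j' := l.-1 - j.
  have iE : i' + j' + o - sw = i by rewrite /i' /j'; case: o lo {tD nS i'} => /=; lia.
  have jE : l.-1 - j' = j by rewrite /j'; lia.
  have lo' : sw <= i' + j' + o by rewrite /i' /j'; case: o lo {tD nS i' iE} => /=; lia.
  split; last by rewrite !negbK iE jE.
  rewrite in_erase memB psiE !negbK below ?negbK ?iE ?jE ?tD //; last by rewrite /j'; lia.
  rewrite (_ : j' < l) /=; last by rewrite /j'; lia.
  apply: contra nS => /and3P[oE j'E]; rewrite oE (_ : j == 0) /=; last by rewrite /j' in j'E; lia.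
  have lE' : j' + o = l by rewrite oE (eqP j'E); lia.
  by rewrite -pos12 -lE' addnA // iE.
- move=> [o [i j]] [o' [i' j']]; rewrite !in_erase !memB.
  move=> /andP[/andP[tR jl] _] /andP[/andP[tR' jl'] _].
  have := below_left tR jl; have := below_left tR' jl'.
  by case: o {tR}; case: o' {tR'} => //=; lia.
Qed.

Lemma tilings_horizontal_cut :
  tilings R * (hyperfact n1 * hyperfact l) =
  \sum_(S : {set 'I_K} | #|S| == z) vdm (pos1 S ++ bases L1) * vdm (pos2 S ++ bases L2).
Proof.
have RE : R = A `|` B.
  apply: utri_fsetP => o i j; rewrite in_fsetU memA memB.
  by case: (_ \in R); rewrite //= leqNgt; case: (j < l).
have u1 S : uniq (pos1 S ++ bases L1).
  rewrite cat_uniq uL1 map_inj_uniq ?enum_uniq ?andbT //; apply/hasPn => i iL.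
  by apply/mapP => -[k _ iE]; have := pos_above k; rewrite -iE iL andbF.
have u2 S : uniq (pos2 S ++ bases L2).
  rewrite cat_uniq uL2 map_inj_in_uniq ?enum_uniq ?andbT //.
    apply/hasPn => i iL; apply/mapP => -[k _ iE].
    by have /and3P[_ _] := pos_below k; rewrite -iE iL.
  move=> k k' _ _ kk; apply: pos_inj.
  by have /and3P[h _ _] := pos_below k; have /and3P[h' _ _] := pos_below k'; lia.
have b1 S : all (gtn N1) (pos1 S).
  by apply/allP => _ /mapP[k _ ->]; have /andP[] := pos_above k.
have b2 S : all (gtn N2) (pos2 S).
  by apply/allP => _ /mapP[k _ ->]; have /and3P[] := pos_below k.
have s1 S : size (pos1 S) = #|S| by rewrite size_map -cardE.
have s2 S : size (pos2 S) = #|S| by rewrite size_map -cardE.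
rewrite RE (@tilings_cut _ phi psi).
(* As [n1 = z + size (bases L1)], a set S of any other size leaves the upper trapezoid unbalanced; a
   set of size z is always admissible, all its positions being free on both sides. *)
- rewrite big_distrl /= [LHS](bigID (fun S : {set 'I_K} => #|S| == z)) /= [X in _ + X]big1 ?addn0.
    apply: eq_big => [S|S /andP[_ /eqP Sz]]; last first.
      rewrite tilings_above tilings_below mulnACA.
      by rewrite !tilings_dtrap // ?s1 ?s2 Sz.
    apply: andb_idl => /eqP Sz; apply/forall_inP => k kS.
    have z0 : 0 < z by rewrite -Sz; apply/card_gt0P; exists k.
    have /andP[p1 p2] := pos_above k; have /and3P[p3 p4 p5] := pos_below k.
    have lS : l.-1 < l by lia.
    have lo : sw <= pos k + l.-1 + ~~ false by rewrite /=; lia.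
    rewrite memA memB leqnn lS !andbT -[l in (true, (_, l))]add0n above (below lS lo).
    rewrite !mem_dtrap /= (_ : (pos k) + l.-1 + 1 - sw = pos k + l - sw); last by lia.
    rewrite subnn !addn0 p1 p4 /=.
    have -> : 0 < n1 by lia.
    have -> : 0 < l by lia.
    apply/andP; split; first by apply: contra p2 => /has_in_tri_base.
    by apply: contra p5 => /has_in_tri_base.
  move=> S /andP[/forall_inP ok Sz].
  (* If [n1] were 0, then z = 0 and no up triangle would be available, so S would be empty and of
     size z. *)
  have n0 : 0 < n1.
    rewrite lt0n; apply: contraNneq Sz => n10; have z0 : z = 0 by lia.
    rewrite z0 cards_eq0 -subset0; apply/subsetP => k /ok /andP[].
    by rewrite memA -[l in (true, (_, l))]add0n above mem_dtrap n10.
  rewrite tilings_above tilings_dtrap_unbalanced ?n0 ?mul0n // s1 n1E.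
  by rewrite eqn_add2r.
- by move=> k k' [] /pos_inj.
- by move=> k k' [] /pos_inj.
- by move=> k /=; lia.
- by apply/fdisjointP => -[o [i j]]; rewrite memA memB => /andP[_ lj]; rewrite ltnNge lj andbF.
- move=> [o [i j]] [o' [i' j']]; rewrite memA memB => /andP[tR lj] /andP[tR' jl'] tt'.
  have [oE o'E jE j'E iE] : [/\ o = true, o' = false, j = l, j' = l.-1 & i' = i].
    by move: tt'; case: o {tR}; case: o' {tR'} => //= h; split => //; lia.
  rewrite oE jE in tR; rewrite o'E j'E iE in tR'.
  have l0 : 0 < l by lia.
  have [k ik] := cells l0 tR tR'.
  by exists k; rewrite ?oE ?o'E ?jE ?j'E ?iE ik.
Qed.

(** The offsets [e1] and [e2] bring the bases of the two trapezoids to a common coordinate, in which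
    the k-th crossing position is [Y + gap k]. *)
Variables (e1 e2 Y : nat) (gap : 'I_K -> nat) (F : seq nat).
Hypothesis gap1 : forall k, e1 + pos k = Y + gap k.
Hypothesis gap2 : forall k, e2 + (pos k + l - sw) = Y + gap k.
Hypothesis permF : perm_eq (map (addn e1) (bases L1) ++ map (addn e2) (bases L2)) F.

(* A crossing lozenge sees the removed triangles above and below the line only
   through the set [F] of all positions they occupy together. *)
Lemma tilings_cut_weight :
  tilings R * (hyperfact n1 * hyperfact l) = vdm (bases L1) * vdm (bases L2) *
  \sum_(S : {set 'I_K} | #|S| == z)
     vdm [seq gap k | k <- enum S] ^ 2 * \prod_(k in S) \prod_(q <- F) dist (Y + gap k) q.
Proof.
rewrite tilings_horizontal_cut big_distrr /=; apply: eq_bigr => S _.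
have v1 : vdm (pos1 S) = vdm [seq gap k | k <- enum S].
  rewrite -(vdm_shift e1) -[RHS](vdm_shift Y) -!map_comp; congr vdm.
  by apply: eq_map => k /=.
have v2 : vdm (pos2 S) = vdm [seq gap k | k <- enum S].
  rewrite -(vdm_shift e2) -[RHS](vdm_shift Y) -!map_comp; congr vdm.
  by apply: eq_map => k /=.
have cr1 : \prod_(p <- pos1 S) \prod_(q <- bases L1) dist p q =
    \prod_(k in S) \prod_(q <- map (addn e1) (bases L1)) dist (Y + gap k) q.
  rewrite big_map big_enum; apply: eq_bigr => k _; rewrite big_map.
  by apply: eq_bigr => q _; rewrite -gap1 dist_add.
have cr2 : \prod_(p <- pos2 S) \prod_(q <- bases L2) dist p q =
    \prod_(k in S) \prod_(q <- map (addn e2) (bases L2)) dist (Y + gap k) q.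
  rewrite big_map big_enum; apply: eq_bigr => k _; rewrite big_map.
  by apply: eq_bigr => q _; rewrite -gap2 dist_add.
have -> : \prod_(k in S) \prod_(q <- F) dist (Y + gap k) q =
    \prod_(p <- pos1 S) \prod_(q <- bases L1) dist p q *
    \prod_(p <- pos2 S) \prod_(q <- bases L2) dist p q.
  rewrite cr1 cr2 -big_split; apply: eq_bigr => k _ /=.
  by rewrite -(perm_big _ permF) big_cat.
by rewrite !vdm_cat v1 v2 -mulnn; ring.
Qed.

End HorizontalCut.

(** * Ferns and hexagons *)

(* Of the segments of lengths [ts] laid end to end from position [p], keep every
   other one, starting with the first one iff [b] holds. *)
Fixpoint alt (b : bool) (p : nat) (ts : seq nat) : seq (nat * nat) :=
  if ts is t :: ts' then
    if b then (p, t) :: alt false (p + t) ts' else alt true (p + t) ts'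
  else [::].

Lemma altS b p t ts :
  alt b p (t :: ts) = (if b then [:: (p, t)] else [::]) ++ alt (~~ b) (p + t) ts.
Proof. by case: b. Qed.

Lemma alt_cat b p s t :
  alt b p (s ++ t) = alt b p s ++ alt (b (+) odd (size s)) (p + sumn s) t.
Proof.
elim: s b p => [|u s IH] b p; first by rewrite addn0 addbF.
by rewrite cat_cons !altS IH -catA /= -addnA; case: b; case: (odd _).
Qed.

Lemma bases_cat L L' : bases (L ++ L') = bases L ++ bases L'.
Proof. by rewrite /bases map_cat flatten_cat. Qed.

Lemma bases1 q : bases [:: q] = iota q.1 q.2.
Proof. exact: cats0. Qed.

(** This is where the subdivision of a fern disappears: its up and down triangles together cover its
    segment exactly once. *)
Lemma perm_bases_alt b p ts :
  perm_eq (bases (alt b p ts) ++ bases (alt (~~ b) p ts)) (iota p (sumn ts)).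
Proof.
elim: ts b p => [|t ts IH] b p //=; rewrite iotaD.
case: b => /=; rewrite /bases /= -/(bases _) -/(bases _).
  by rewrite -catA perm_cat2l; apply: (IH false).
by rewrite perm_catCA perm_cat2l; apply: (IH true).
Qed.

Lemma bases_alt_shift e b p ts : map (addn e) (bases (alt b p ts)) = bases (alt b (e + p) ts).
Proof.
elim: ts b p => [|t ts IH] b p //; rewrite !altS !bases_cat map_cat IH -addnA; congr (_ ++ _).
by case: b; rewrite // /bases /= !cats0 iotaDl.
Qed.

Lemma osum_cons t ts : osum (t :: ts) = t + esum ts.
Proof.
rewrite /osum /esum big_mkcond big_ord_recl /= [in RHS]big_mkcond; congr (_ + _).
by apply: eq_bigr => i _ /=; rewrite negbK.
Qed.

Lemma esum_cons t ts : esum (t :: ts) = osum ts.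
Proof.
rewrite /osum /esum big_mkcond big_ord_recl /= add0n [in RHS]big_mkcond.
by apply: eq_bigr => i _ /=.
Qed.

Lemma size_bases_alt b p ts : size (bases (alt b p ts)) = if b then osum ts else esum ts.
Proof.
elim: ts b p => [|t ts IH] b p; first by case: b; rewrite /osum /esum big_ord0.
rewrite altS bases_cat size_cat IH osum_cons esum_cons.
by case: b; rewrite // /bases /= cats0 size_iota.
Qed.

Lemma osum_esum ts : osum ts + esum ts = sumn ts.
Proof.
have := perm_size (perm_bases_alt true 0 ts).
by rewrite size_cat !size_bases_alt size_iota.
Qed.

(** The right fern is indexed from right to left but laid out from left to right; for even length
    this exchanges the odd and even sums. *)
Lemma size_bases_rev b ts :
  size (bases (alt b 0 (rev ts))) = if b (+) odd (size ts) then esum ts else osum ts.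
Proof.
elim: ts b => [|t ts IH] b; first by case: b; rewrite /= /osum /esum big_ord0.
rewrite rev_cons -cats1 alt_cat bases_cat size_cat IH osum_cons esum_cons size_rev /=.
by case: b; case: (odd _) => /=; rewrite /bases /= ?cats0 ?size_iota ?addn0 // addnC.
Qed.

Lemma osum_rev ts : ~~ odd (size ts) -> osum (rev ts) = esum ts.
Proof. by move=> /negbTE h; have := size_bases_rev true ts; rewrite size_bases_alt h. Qed.

Lemma esum_rev ts : ~~ odd (size ts) -> esum (rev ts) = osum ts.
Proof. by move=> /negbTE h; have := size_bases_rev false ts; rewrite size_bases_alt h. Qed.

Lemma alt_bounds b p ts q : q \in alt b p ts -> q.1 + q.2 <= p + sumn ts.
Proof.
elim: ts b p => [|t ts IH] b p //; rewrite altS mem_cat => /orP[|/IH] /=; last by lia.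
by case: b; rewrite ?in_nil // inE => /eqP -> /=; lia.
Qed.

Lemma size_le_bases q L : q \in L -> q.2 <= size (bases L).
Proof.
elim: L => // q' L IH; rewrite inE -[q' :: L]cat1s bases_cat size_cat => /orP[/eqP ->|/IH].
  by rewrite /bases /= cats0 size_iota leq_addr.
by move=> h; apply: leq_trans h _; apply: leq_addl.
Qed.

Lemma base_in_tri i L : i \in bases L -> has (in_tri (true, (i, 0))) L.
Proof.
case/flattenP => _ /mapP[q qL ->]; rewrite mem_iota => h.
by apply/hasP; exists q => //=; lia.
Qed.

Lemma mem_hexagon n ne se s sw nw (o : bool) (i j : nat) :
  ((o, (i, j)) \in hexagon n ne se s sw nw) =
  [&& i < n + ne, j < sw + nw, sw <= i + j + ~~ o & i + j + ~~ o < sw + s + se].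
Proof.
transitivity (((o, (i, j)) \in box (n + ne).+1 (sw + nw).+1) &&
  inside (fun q => [&& q.1 <= n + ne, q.2 <= sw + nw & sw <= q.1 + q.2 <= sw + s + se]) (o, (i, j))).
  by rewrite !inE.
by rewrite mem_box /inside /=; case: o => /=; lia.
Qed.

Lemma mem_remove (R : {fset utri}) D t :
  (t \in remove R D) = (t \in R) && ~~ has (fun S => inside S t) D.
Proof. by rewrite !inE. Qed.

Lemma inside_above s p l (o : bool) (i j : nat) :
  inside (triangle true s (p, l)) (o, (i, j + l)) = in_tri (o, (i, j)) (p, s).
Proof. by rewrite /inside /triangle /=; case: o => /=; lia. Qed.

Lemma inside_above0 s p l (o : bool) (i j : nat) :
  inside (triangle false s (p, l)) (o, (i, j + l)) = false.
Proof. by rewrite /inside /triangle /=; case: o => /=; lia. Qed.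

Lemma inside_below s p l sw (o : bool) (i j : nat) :
  j < l -> sw <= i + j + ~~ o -> sw <= p + l ->
  inside (triangle false s (p, l)) (o, (i, j)) =
  in_tri (~~ o, (i + j + ~~ o - sw, l.-1 - j)) (p + l - sw, s).
Proof. by rewrite /inside /triangle /=; case: o => /=; lia. Qed.

Lemma inside_below0 s p l (o : bool) (i j : nat) : j < l ->
  inside (triangle true s (p, l)) (o, (i, j)) = false.
Proof. by rewrite /inside /triangle /=; case: o => /=; lia. Qed.

Lemma has_fern_above b p l ts (o : bool) (i j : nat) :
  has (fun S => inside S (o, (i, j + l))) (fern b p l ts) = has (in_tri (o, (i, j))) (alt b p ts).
Proof.
elim: ts b p => [|t ts IH] b p //; rewrite altS has_cat -IH; cbn [fern has].
by case: b; rewrite ?inside_above ?inside_above0 //= orbF.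
Qed.

Lemma has_fern_below b p l sw ts (o : bool) (i j : nat) :
  j < l -> sw <= i + j + ~~ o -> sw <= p + l ->
  has (fun S => inside S (o, (i, j))) (fern b p l ts) =
  has (in_tri (~~ o, (i + j + ~~ o - sw, l.-1 - j))) (alt (~~ b) (p + l - sw) ts).
Proof.
move=> jl lo; elim: ts b p => [|t ts IH] b p // lp; rewrite altS has_cat negbK; cbn [fern has].
rewrite (_ : p + l - sw + t = p + t + l - sw); last by lia.
rewrite IH ?negbK; last by lia.
by case: b; rewrite ?inside_below0 ?(@inside_below _ _ _ sw) //= ?negbK ?orbF.
Qed.

Lemma dented_semihexagonE ts :
  dented_semihexagon ts = dtrap (sumn ts) (osum ts) [::] (alt true 0 ts).
Proof.
have hasE (o : bool) (i j : nat) p :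
    has (fun S => inside S (o, (i, j))) (dents p ts) = has (in_tri (o, (i, j))) (alt true p ts).
  have ins s q : inside (triangle true s (q, 0)) (o, (i, j)) = in_tri (o, (i, j)) (q, s).
    by rewrite -[j in LHS]addn0 inside_above.
  have [n] := ubnP (size ts); elim: n ts p => // n IH [|t1 [|t2 us]] p sz //.
    by cbn [dents alt has]; rewrite ins.
  by cbn [dents alt has]; rewrite ins IH //; move: sz => /=; lia.
apply: utri_fsetP => o i j; rewrite mem_remove mem_hexagon hasE mem_dtrap in_nil -osum_esum.
by case: (has _ _); rewrite ?andbF //; case: o => /=; lia.
Qed.

Lemma semihex_vdm ts : semihex ts * hyperfact (osum ts) = vdm (bases (alt true 0 ts)).
Proof.
rewrite /semihex dented_semihexagonE tilings_dtrap //.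
- have := perm_uniq (perm_bases_alt true 0 ts); rewrite iota_uniq cat_uniq.
  by case/and3P.
- apply/allP => q qL; have := alt_bounds qL; have := size_le_bases qL.
  by rewrite size_bases_alt add0n => -> ->.
- by rewrite size_bases_alt.
Qed.

(** * The cored hexagon *)

Definition gap (g c k : nat) : nat := if k < g then k else k + c.

Lemma gap_inj g c : injective (gap g c).
Proof. by move=> k k'; rewrite /gap; case: ifP; case: ifP; lia. Qed.

(* Blocks of lengths Y, c, Y separated by gaps of lengths g, g'; the k-th free
   position is Y + gap g c k. *)
Definition blocks (Y g c g' : nat) : seq nat :=
  iota 0 Y ++ iota (Y + g) c ++ iota (Y + g + c + g') Y.

Lemma gap_notin_blocks Y g c g' (k : 'I_(g + g')) :
  (Y + gap g c k \notin blocks Y g c g') && (Y + gap g c k < Y + g + c + g').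
Proof.
rewrite /blocks !mem_cat !mem_iota /gap; have := ltn_ord k.
by case: ifP; lia.
Qed.

Lemma notin_blocks_gap Y g c g' v : v \notin blocks Y g c g' -> v < Y + g + c + g' + Y ->
  exists k : 'I_(g + g'), v = Y + gap g c k.
Proof.
rewrite /blocks !mem_cat !mem_iota => h1 h2.
have [vg|gv] := ltnP v (Y + g).
  have kK : v - Y < g + g' by lia.
  by exists (Ordinal kK); rewrite /gap /=; case: ifP; lia.
have kK : v - Y - c < g + g' by lia.
by exists (Ordinal kK); rewrite /gap /=; case: ifP; lia.
Qed.

(** The factor shared by the two regions; it involves the ferns only through [Y], [c] and the
    gaps. *)
Definition gap_sum (Y g c g' z : nat) : nat :=
  \sum_(S : {set 'I_(g + g')} | #|S| == z)
    vdm [seq gap g c k | k : 'I_(g + g') <- enum S] ^ 2 *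
    \prod_(k in S) \prod_(q <- blocks Y g c g') dist (Y + gap g c k) q.

Lemma blocks_uniq Y g c g' : uniq (blocks Y g c g').
Proof.
rewrite /blocks !cat_uniq !iota_uniq /= andbT; apply/andP; split.
  by apply/hasPn => i; rewrite mem_cat !mem_iota; lia.
by apply/hasPn => i; rewrite !mem_iota; lia.
Qed.

Lemma tilings_cored_hexagon x Y z c g g' : g = (x + z)./2 -> g' = uphalf (x + z) ->
  odd x != odd z ->
  tilings (cored_hexagon x (2 * Y + z) z c) * (hyperfact (z + (Y + c)) * hyperfact (z + Y)) =
  vdm (iota 0 Y ++ iota (Y + g) c) * hyperfact Y * gap_sum Y g c g' z.
Proof.
move=> gE g'E oxz.
have xz : x + z = g + g' by rewrite gE g'E uphalf_half; lia.
have gg' : g' = g.+1 by rewrite gE g'E uphalf_half; lia.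
(* Only x has the odd-one-out parity, so the core is shifted half a unit west, which puts the
   smaller gap [g] on its left as for the middle fern. *)
have core : core_vertex x (2 * Y + z) z = (Y + g, Y + z).
  rewrite /core_vertex oddD oddM /= (negbTE oxz) eqxx /=.
  by congr (_, _); lia.
(* The cut at level [z + Y] is Y rows below the west vertex and Y rows above the east vertex: one
   corner triangle of side Y completes the upper half on the left, the other the lower half on the
   right. *)
pose L1 := [:: (0, Y); (Y + g, c)]; pose L2 := [:: (g + c + g', Y)].
have B1 : bases L1 = iota 0 Y ++ iota (Y + g) c by rewrite /bases /= cats0.
have B2 : bases L2 = iota (g + c + g') Y by rewrite /bases /= cats0.
have lE : Y + z = z + Y by rewrite addnC.
rewrite -B1 -(vdm_iota (g + c + g') Y) -B2.
have mem (o : bool) (i j : nat) : ((o, (i, j)) \in cored_hexagon x (2 * Y + z) z c) =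
  [&& i < x + (2 * Y + z + c), j < 2 * Y + z + (z + c), 2 * Y + z <= i + j + ~~ o
   & i + j + ~~ o < 2 * Y + z + (x + c) + z] && ~~ inside (triangle true c (Y + g, z + Y)) (o, (i, j)).
  by rewrite mem_remove mem_hexagon /= core orbF lE.
have ab (o : bool) (i j : nat) : ((o, (i, j + (z + Y))) \in cored_hexagon x (2 * Y + z) z c) =
    ((o, (i, j)) \in dtrap (Y + g + c + g') (z + (Y + c)) [::] L1).
  rewrite mem inside_above mem_dtrap in_nil /L1 /=.
  by case: o => /=; lia.
have be (o : bool) (i j : nat) : j < z + Y -> 2 * Y + z <= i + j + ~~ o ->
    ((o, (i, j)) \in cored_hexagon x (2 * Y + z) z c) =
    ((~~ o, (i + j + ~~ o - (2 * Y + z), (z + Y).-1 - j)) \in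
       dtrap (g + c + g' + Y) (z + Y) [::] L2).
  move=> jl lo; rewrite mem inside_below0 // mem_dtrap in_nil /L2 /=.
  by case: o lo => /=; lia.
apply: (@tilings_cut_weight _ _ (fun k => Y + gap g c k) (z + Y) (2 * Y + z)
  (Y + g + c + g') (z + (Y + c)) (g + c + g' + Y) z L1 L2 _ ab _ be _ _ _ _ _ _ _ _ _ _ _ _ 0 Y Y).
- by move=> k k' /addnI/gap_inj/val_inj.
- by move=> o i j; rewrite mem => /andP[/and4P[]].
- by move=> o i j _; case: o; lia.
- move=> p l0; rewrite -[z + Y]add0n ab add0n => up dn.
  have lo : 2 * Y + z <= p + (z + Y).-1 + ~~ false.
    by move: dn; rewrite mem => /andP[/and4P[]].
  move: dn; rewrite be //; last by lia.
  move: up; rewrite !mem_dtrap /= /L1 /L2 /= => up dn.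
  apply: (notin_blocks_gap (v := p)); last by lia.
  by rewrite /blocks !mem_cat !mem_iota; move: up dn lo => /=; lia.
- move=> k; rewrite B1; have := gap_notin_blocks Y c k.
  by rewrite /blocks !mem_cat !negb_or => /andP[/and3P[-> -> _] ->].
- move=> k; rewrite B2; have := gap_notin_blocks Y c k.
  by rewrite /blocks !mem_cat !negb_or !mem_iota => /andP[/and3P[_ _ h] h'];
     apply/and3P; split; lia.
- by have := blocks_uniq Y g c g'; rewrite /blocks catA cat_uniq B1 => /and3P[].
- by rewrite B2 iota_uniq.
- by rewrite /L1 /=; lia.
- by rewrite /L2 /=; lia.
- by rewrite B1 size_cat !size_iota.
- by rewrite B2 size_iota.
- by lia.
- by lia.
- by move=> k.
- by move=> k; lia.
- rewrite (eq_map (g := id)) // map_id B1 B2 -iotaDl -catA /blocks.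
  by rewrite (_ : Y + (g + c + g') = Y + g + c + g') ?perm_refl //; lia.
Qed.

(** * The region with three ferns *)

Section ThreeFerns.

Variables (x y z : nat) (ta tb tc : seq nat).
Hypothesis eb : ~~ odd (size tb).

Let a := sumn ta.
Let b := sumn tb.
Let c := sumn tc.
Let g := (x + z)./2.
Let g' := uphalf (x + z).
Let alpha := y + (b - a).
Let beta := y + (a - b).
Let O := osum ta + osum tb + osum tc.
Let E := esum ta + esum tb + esum tc.
Let Y := alpha + a.

Definition Q_up_dents : seq (nat * nat) :=
  alt true 0 ta ++ alt true (a + g) tc ++ alt false (a + g + c + g') (rev tb).

(** The first and last entries are the corner triangles at the west and east vertices. Positions
    start at the left corner, hence the offset [alpha] from those of [Q_up_dents]. *)
Definition Q_down_dents : seq (nat * nat) :=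
  (0, alpha) :: alt false alpha ta ++ alt false (alpha + a + g) tc ++
  alt true (alpha + a + g + c + g') (rev tb) ++ [:: (alpha + a + g + c + g' + b, beta)].

Let xz : x + z = g + g'. Proof. by rewrite /g /g' uphalf_half; lia. Qed.
Let Yb : beta + b = Y. Proof. by rewrite /Y /alpha /beta; lia. Qed.
Let OE : O + E = a + b + c.
Proof. by rewrite /O /E /a /b /c -!osum_esum; lia. Qed.
Let sumr : sumn (rev tb) = b. Proof. exact: sumn_rev. Qed.

Lemma size_Q_up_dents : size (bases Q_up_dents) = O.
Proof. by rewrite !bases_cat !size_cat !size_bases_alt esum_rev // /O [osum tc + _]addnC addnA. Qed.

Lemma size_Q_down_dents : size (bases Q_down_dents) = alpha + beta + E.
Proof.
rewrite /Q_down_dents -cat1s !bases_cat !size_cat !size_bases_alt osum_rev //.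
by rewrite !size_iota /= /E; lia.
Qed.

(** The ferns fill their segments, and [alpha + a = beta + b = Y] makes the outer blocks equal. *)
Lemma perm_Q_dents :
  perm_eq (map (addn alpha) (bases Q_up_dents) ++ map (addn 0) (bases Q_down_dents))
          (blocks Y g c g').
Proof.
rewrite (eq_map (f := addn 0) (g := id)) // map_id.
rewrite /Q_up_dents /Q_down_dents -cat1s !bases_cat !map_cat !bases_alt_shift.
rewrite /blocks [iota 0 Y]iotaD (_ : iota _ Y = iota (Y + g + c + g') b ++
  iota (Y + g + c + g' + b) beta); last by rewrite -iotaD [b + beta]addnC Yb.
rewrite !bases1; apply/permP => P; rewrite !count_cat add0n addn0 !addnA.
have ca := permP (perm_bases_alt true alpha ta) P.
have cc := permP (perm_bases_alt true (alpha + a + g) tc) P.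
have cb := permP (perm_bases_alt true (alpha + a + g + c + g') (rev tb)) P.
move: ca cc cb; rewrite !count_cat /= sumr -/a -/c /Y => ca cc cb.
by lia.
Qed.

Lemma tilings_Qleft :
  tilings (Qleft x y z ta tc tb) * (hyperfact (z + O) * hyperfact (z + (alpha + beta + E))) =
  vdm (bases Q_up_dents) * vdm (bases Q_down_dents) * gap_sum Y g c g' z.
Proof.
(* The level of the line, written as z plus the number of lower dents, the form that balance of the
   lower half requires. *)
set l := z + (alpha + beta + E); set sw := y + z + E + (a - b).
have lsw : l = sw + alpha by rewrite /l /sw /alpha /beta; lia.
have mem (o : bool) (i j : nat) : ((o, (i, j)) \in Qleft x y z ta tc tb) =
  [&& i < x + E + (y + z + O + (a - b)), j < sw + (y + z + O + (b - a)),
     sw <= i + j + ~~ o & i + j + ~~ o < sw + (x + O) + (y + z + E + (b - a))] &&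
  ~~ [|| has (fun S => inside S (o, (i, j))) (fern true 0 l ta),
         has (fun S => inside S (o, (i, j))) (fern true (a + g) l tc)
       | has (fun S => inside S (o, (i, j))) (fern false (a + g + c + g') l (rev tb))].
  rewrite mem_remove mem_hexagon !has_cat (negbTE eb) -/a -/b -/c -/O -/E -/g -/g' -/sw.
  by rewrite (_ : y + z + E + (b - a) + (y + (a - b)) = l) //; rewrite /l /alpha /beta; lia.
have ab (o : bool) (i j : nat) : ((o, (i, j + l)) \in Qleft x y z ta tc tb) =
    ((o, (i, j)) \in dtrap (a + g + c + g' + b) (z + O) [::] Q_up_dents).
  rewrite mem !has_fern_above mem_dtrap in_nil !has_cat lsw.
  case: (has _ _); rewrite /= ?andbF //; case: (has _ _); rewrite /= ?andbF //.
  by case: (has _ _); rewrite /= ?andbF // ?andbT; rewrite /alpha /sw; case: o => /=; lia.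
have be (o : bool) (i j : nat) : j < l -> sw <= i + j + ~~ o ->
    ((o, (i, j)) \in Qleft x y z ta tc tb) =
    ((~~ o, (i + j + ~~ o - sw, l.-1 - j)) \in
       dtrap (alpha + a + g + c + g' + b + beta) l [::] Q_down_dents).
  move=> jl lo.
  have fb b0 p ts : has (fun S => inside S (o, (i, j))) (fern b0 p l ts) =
      has (in_tri (~~ o, (i + j + ~~ o - sw, l.-1 - j))) (alt (~~ b0) (alpha + p) ts).
    rewrite (has_fern_below _ _ jl lo); last by lia.
    by congr (has _ (alt _ _ _)); lia.
  rewrite mem !fb addn0 !addnA mem_dtrap in_nil /Q_down_dents -cat1s !has_cat.
  cbn [has negb]; rewrite !orbF.
  case: (has _ _); rewrite /= ?orbT ?andbF //; case: (has _ _); rewrite /= ?orbT ?andbF //.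
  case: (has _ _); rewrite /= ?orbT ?andbF //=.
  by move: lo; rewrite /alpha /beta /sw /l; case: o {fb} => /=; lia.
have Bup i : i \in bases Q_up_dents -> alpha + i \in blocks Y g c g'.
  by move=> h; rewrite -(perm_mem perm_Q_dents) mem_cat map_f.
have Bdn i : i \in bases Q_down_dents -> i \in blocks Y g c g'.
  move=> h; rewrite -(perm_mem perm_Q_dents) mem_cat; apply/orP; right.
  by rewrite (eq_map (f := addn 0) (g := id)) // map_id.
have := blocks_uniq Y g c g'; rewrite -(perm_uniq perm_Q_dents) cat_uniq => /and3P[u1 _ u2].
apply: (@tilings_cut_weight _ _ (fun k => a + gap g c k) l sw
  (a + g + c + g' + b) (z + O) (alpha + a + g + c + g' + b + beta) z
  Q_up_dents Q_down_dents _ ab _ be _ _ _ _ _ _ _ _ _ _ _ _ alpha 0 Y).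
- by move=> k k' /addnI/gap_inj/val_inj.
- by move=> o i j; rewrite mem => /andP[/and4P[]].
- move=> o i j; rewrite mem_dtrap => /and3P[jl _]; rewrite /= negb_or => /andP[h _].
  by move: jl h; rewrite lsw; case: o => /=; lia.
- move=> p l0; rewrite -[l]add0n ab add0n => up dn.
  have lo : sw <= p + l.-1 + ~~ false by move: dn; rewrite mem => /andP[/and4P[]].
  move: dn; rewrite be //; last by lia.
  rewrite subnn (_ : p + l.-1 + ~~ false - sw = alpha + p) => [dn|]; last by rewrite /=; lia.
  (* Both triangles at p are present, so p is a base position of no removed triangle above or below;
     outside the blocks only the gaps remain. *)
  have [k kE] : exists k : 'I_(g + g'), alpha + p = Y + gap g c k.
    apply: notin_blocks_gap.
      rewrite -(perm_mem perm_Q_dents) mem_cat negb_or; apply/andP; split.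
        rewrite mem_map; last by move=> ? ? /addnI.
        move: up; rewrite mem_dtrap => /and3P[_ _]; apply: contra.
        exact: base_in_tri.
      rewrite (eq_map (f := addn 0) (g := id)) // map_id.
      move: dn; rewrite mem_dtrap => /and3P[_ _]; apply: contra.
      exact: base_in_tri.
    by move: up; rewrite mem_dtrap => /and3P[_ /andP[h _] _]; lia.
  by exists k; move: kE; rewrite /Y; lia.
- move=> k; have /andP[h1 h2] := gap_notin_blocks Y c k; apply/andP; split.
    by move: h2; rewrite /Y; lia.
  by apply: contra h1 => /Bup; rewrite addnA.
- move=> k; have /andP[h1 h2] := gap_notin_blocks Y c k.
  have pE : a + gap g c k + l - sw = Y + gap g c k by rewrite /Y; lia.
  rewrite pE; apply/and3P; split; [by lia| |by apply: contra h1 => /Bdn].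
  by move: h2; rewrite /Y; lia.
- by move: u1; rewrite map_inj_uniq // => ? ? /addnI.
- by move: u2; rewrite map_inj_uniq.
- apply/allP => q qL; have := size_le_bases qL; rewrite size_Q_up_dents => h.
  apply/andP; split; last exact: leq_trans h (leq_addl _ _).
  move: qL; rewrite !mem_cat => /or3P[] /alt_bounds; rewrite ?sumr -/a -/c;
    by move: (q.1 + q.2); lia.
- apply/allP => q qL; have := size_le_bases qL; rewrite size_Q_down_dents => h.
  apply/andP; split; last exact: leq_trans h (leq_addl _ _).
  move: qL; rewrite /Q_down_dents inE !mem_cat inE => /orP[/eqP ->|/or4P[]] /=; first by lia.
  + by move/alt_bounds; rewrite -/a; move: (q.1 + q.2); lia.
  + by move/alt_bounds; rewrite -/c; move: (q.1 + q.2); lia.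
  + by move/alt_bounds; rewrite sumr; move: (q.1 + q.2); lia.
  + by move/eqP => -> /=.
- by rewrite size_Q_up_dents.
- by rewrite size_Q_down_dents.
- by lia.
- by rewrite /l; lia.
- by move=> k; rewrite /Y addnA.
- by move=> k; rewrite /Y; lia.
- exact: perm_Q_dents.
Qed.

End ThreeFerns.

(** * Semihexagon sequences and assembly of the formula *)

(** Fill the gap with an interval of length g: the pairs between the two outer blocks then arise by
    comparing the intervals of lengths [Y + c + g], [Y + g], [c + g] and g. This is the source of
    the hyperfactorials involving g. *)
Lemma vdm_two_blocks Y g c :
  vdm (iota 0 Y ++ iota (Y + g) c) * (hyperfact (Y + g) * hyperfact (c + g)) =
  hyperfact c * hyperfact Y * hyperfact (Y + c + g) * hyperfact g.
Proof.
rewrite -(vdm_iota 0 (Y + g)) [c + g]addnC -(vdm_iota Y (g + c)).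
rewrite (_ : Y + c + g = Y + (g + c)); last by lia.
rewrite -(vdm_iota 0 (Y + (g + c))) !iotaD !add0n !vdm_cat !vdm_iota.
have -> : \prod_(p <- iota 0 Y) \prod_(q <- iota Y g ++ iota (Y + g) c) dist p q =
    \prod_(p <- iota 0 Y) \prod_(q <- iota Y g) dist p q *
    \prod_(p <- iota 0 Y) \prod_(q <- iota (Y + g) c) dist p q.
  by rewrite -big_split; apply: eq_bigr => p _; rewrite big_cat.
ring.
Qed.

Lemma add_last_rcons d s u : add_last d (rcons s u) = rcons s (u + d).
Proof.
by rewrite /add_last size_rcons last_rcons /=; elim: s => //= v s ->.
Qed.

(** In an even-length sequence the last segment is a space, so lengthening it moves no triangle. *)
Lemma alt_add_last d p ts : 0 < size ts -> ~~ odd (size ts) ->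
  alt true p (add_last d ts) = alt true p ts.
Proof.
case/lastP: ts => // s u _; rewrite size_rcons /= negbK => os.
by rewrite add_last_rcons -!cats1 !alt_cat os.
Qed.

Lemma size_add_last d ts : 0 < size ts -> size (add_last d ts) = size ts.
Proof. by case/lastP: ts => // s u _; rewrite add_last_rcons !size_rcons. Qed.

Lemma sumn_add_last d ts : 0 < size ts -> sumn (add_last d ts) = sumn ts + d.
Proof. by case/lastP: ts => // s u _; rewrite add_last_rcons !sumn_rcons; lia. Qed.

Lemma alt_add_head d p ts : 0 < size ts -> alt false p (add_head d ts) = alt false (p + d) ts.
Proof. by case: ts => //= u s _; congr alt; lia. Qed.

Lemma size_add_head d ts : 0 < size ts -> size (add_head d ts) = size ts.
Proof. by case: ts. Qed.

Lemma sumn_add_head d ts : 0 < size ts -> sumn (add_head d ts) = sumn ts + d.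
Proof. by case: ts => //= u s _; lia. Qed.

(** Seen from above the line, the down triangles of sides a_m, c_k and b_n are spaces, so they
    absorb the adjacent gaps: a_m takes g, while c_k, g' and b_n become one space. *)
Lemma alt_semihex_up x z ta tb tc (g := (x + z)./2) (g' := uphalf (x + z)) :
  0 < size ta -> ~~ odd (size ta) -> 0 < size tb -> 0 < size tc -> ~~ odd (size tc) ->
  alt true 0 (add_last g ta ++ add_last (g' + last 0 tb) tc ++ behead (rev tb)) =
  Q_up_dents x z ta tb tc.
Proof.
move=> na ea nb nc ec.
rewrite !alt_cat !alt_add_last // !size_add_last // !sumn_add_last //.
rewrite (negbTE ea) (negbTE ec) /Q_up_dents -/g -/g' add0n; congr (_ ++ (_ ++ _)).
  exact: alt_add_last.
case/lastP: tb nb => // s u _; rewrite rev_rcons last_rcons /=.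
by congr alt; lia.
Qed.

(** Seen from below the roles are exchanged: c_1 is a space and absorbs g, whereas g' lies between
    the dents c_k and b_n and stays a separate term. The two corners are the outermost dents. *)
Lemma alt_semihex_down x y z ta tb tc (a := sumn ta) (b := sumn tb)
    (g := (x + z)./2) (g' := uphalf (x + z)) :
  ~~ odd (size ta) -> ~~ odd (size tb) -> 0 < size tc -> ~~ odd (size tc) ->
  alt true 0 ((y + (b - a)) :: ta ++ add_head g tc ++ g' :: rev tb ++ [:: y + (a - b)]) =
  Q_down_dents x y z ta tb tc.
Proof.
move=> ea eb nc ec.
rewrite /Q_down_dents -/a -/b -/g -/g' altS add0n; congr (_ :: _).
rewrite !alt_cat (negbTE ea) alt_add_head // size_add_head // (negbTE ec) sumn_add_head //.
rewrite -/a; congr (_ ++ (_ ++ _)).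
rewrite altS alt_cat size_rev (negbTE eb) sumn_rev -/b /=.
by congr (alt _ _ _ ++ [:: (_, _)]); lia.
Qed.

Import GRing.Theory Num.Theory.
Local Open Scope ring_scope.

Theorem theorem2p7 (x y z : nat) (ta tb tc : seq nat)
  (hxz : odd x != odd z)
  (hm0 : (0 < size ta)%N) (hm : ~~ odd (size ta))
  (hn0 : (0 < size tb)%N) (hn : ~~ odd (size tb))
  (hk0 : (0 < size tc)%N) (hk : ~~ odd (size tc)) :
  let a := sumn ta in let b := sumn tb in let c := sumn tc in
  let O := (osum ta + osum tb + osum tc)%N in
  let E := (esum ta + esum tb + esum tc)%N in
  let g := ((x + z)./2)%N in let g' := uphalf (x + z) in
  let mu := maxn a b in let nu := minn a b in
  let d := (mu - nu)%N in
  let H (n : nat) : rat := (hyperfact n)%:R in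
  (tilings (Qleft x y z ta tc tb))%:R =
    (tilings (cored_hexagon x (2 * y + z + 2 * mu) z c))%:R
    * (semihex (add_last g ta ++ add_last (g' + last 0 tb)%N tc
                ++ behead (rev tb)))%:R
    * (semihex ((y + b - nu)%N :: ta ++ add_head g tc
                ++ g' :: rev tb ++ [:: (y + a - nu)%N]))%:R
    * (H (c + g)%N / (H c * H g))
    * (H (mu + y + g)%N / H (mu + c + y + g)%N)
    * (H (mu + y + z)%N * H (mu + c + y + z)%N
       / (H (O + z)%N * H (d + E + 2 * y + z)%N))
    * (H O * H (d + E + 2 * y)%N / H (mu + y)%N ^+ 2) :> rat.
Proof.
move=> a b c O E g g' mu nu d H.
have H0 n : H n != 0.
  by rewrite /H pnatr_eq0 -lt0n prodn_gt0 // => i; apply: fact_gt0.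
pose Y := (mu + y)%N.
have YE : (y + (b - a) + a = Y)%N by rewrite /Y /mu; lia.
have alE : (y + b - nu = y + (b - a))%N by rewrite /nu; lia.
have beE : (y + a - nu = y + (a - b))%N by rewrite /nu; lia.
have DE : (y + (b - a) + (y + (a - b)) + E = d + E + 2 * y)%N by rewrite /d /mu /nu; lia.
have XE : (2 * y + z + 2 * mu = 2 * Y + z)%N by rewrite /Y; lia.
have eQ := tilings_Qleft x y z ta tc hn.
have eC := @tilings_cored_hexagon x Y z c g g' erefl erefl hxz.
pose tU := add_last g ta ++ add_last (g' + last 0 tb)%N tc ++ behead (rev tb).
pose tD := (y + (b - a))%N :: ta ++ add_head g tc ++ g' :: rev tb ++ [:: (y + (a - b))%N].
have aU : alt true 0 tU = Q_up_dents x z ta tb tc by apply: alt_semihex_up.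
have aD : alt true 0 tD = Q_down_dents x y z ta tb tc by apply: alt_semihex_down.
have eU := semihex_vdm tU; have eD := semihex_vdm tD.
have oU : osum tU = O.
  by have := size_bases_alt true 0 tU; rewrite aU size_Q_up_dents.
have oD : osum tD = (d + E + 2 * y)%N.
  by have := size_bases_alt true 0 tD; rewrite aD size_Q_down_dents // -/a -/b -/E DE.
have eV := vdm_two_blocks Y g c.
rewrite aU oU in eU; rewrite aD oD in eD.
rewrite -/a -/b -/c -/O -/E -/g -/g' YE DE -eU -eD in eQ.
rewrite alE beE XE -/tU -/tD.
have -> : (mu + y + g = Y + g)%N by [].
have -> : (mu + c + y + g = Y + c + g)%N by rewrite /Y; lia.
have -> : (mu + y + z = z + Y)%N by rewrite /Y; lia.
have -> : (mu + c + y + z = z + (Y + c))%N by rewrite /Y; lia.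
rewrite [(O + z)%N]addnC [(d + E + 2 * y + z)%N]addnC -/Y.
set G := gap_sum _ _ _ _ _ in eQ eC; set V := vdm _ in eC eV; set D := (d + E + 2 * y)%N in eQ *.
have eQr : (tilings (Qleft x y z ta tc tb))%:R = 
    ((semihex tU)%:R * H O) * ((semihex tD)%:R * H D) * G%:R / (H (z + O)%N * H (z + D)%N).
  apply: (canRL (mulfK _)); first by rewrite mulf_neq0.
  by rewrite /H -!natrM eQ.
have eVr : V%:R = H c * H Y * H (Y + c + g)%N * H g / (H (Y + g)%N * H (c + g)%N).
  apply: (canRL (mulfK _)); first by rewrite mulf_neq0.
  by rewrite /H -!natrM eV.
have eCr : (tilings (cored_hexagon x (2 * Y + z) z c))%:R =
    V%:R * H Y * G%:R / (H (z + (Y + c))%N * H (z + Y)%N).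
  apply: (canRL (mulfK _)); first by rewrite mulf_neq0.
  by rewrite /H -!natrM eC.
(* [G] is a common factor of both sides. The square of [H Y] to be cancelled has one factor from [V]
   and one from the corner in the lower half of the cored hexagon. *)
rewrite eQr eCr eVr; field.
by rewrite !H0.
Qed.
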